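(* Let $x$ be a compact infinite dimensional (infinite rank) normal operator on $l_2$ with the spectral representation $x=\sum_{n=1}^\infty\lambda_nP_n$ (the series converging in the operator norm $\|\cdot\|_{l_2\to l_2}$). Then the following assertions are equivalent: (i) $x\in L(s',s)$ (as an operator on $l_2$); (ii) $P_n\in L(s',s)$ for $n\in\mathbb N$ and $(|\lambda_n|^\theta\|P_n\|_q)_{n\in\mathbb N}\in s$ for all $q\in\mathbb N_0$ and every $\theta\in(0,1]$; (iii) $P_n\in L(s',s)$ for $n\in\mathbb N$, $(\lambda_n)_{n\in\mathbb N}\in s$ and $\sup_{n\in\mathbb N}|\lambda_n|\,\|P_n\|_q<\infty$ for all $q\in\mathbb N_0$; (iv) $P_n\in L(s',s)$ for $n\in\mathbb N$ and $\sum_{n=1}^\infty|\lambda_n|\,\|P_n\|_q<\infty$ for all $q\in\mathbb N_0$. Moreover, if $x=\sum_{n=1}^N\lambda_nP_n$ is (the spectral representation of) a finite dimensional (finite rank) normal operator on $l_2$, then $x\in L(s',s)$ if and only if $P_n\in L(s',s)$ for $n=1,\dots,N$.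
   Context: $\mathbb N=\{1,2,\dots\}$, $\mathbb N_0=\mathbb N\cup\{0\}$. $s$ is the Fréchet space of complex sequences $\xi=(\xi_j)_{j\in\mathbb N}$ with $|\xi|_q:=(\sum_{j}|\xi_j|^2j^{2q})^{1/2}<\infty$ for all $q\in\mathbb N_0$, with the topology of the norms $(|\cdot|_q)_{q\in\mathbb N_0}$. $s'$ is the space of complex sequences with $|\xi|'_q:=(\sum_j|\xi_j|^2j^{-2q})^{1/2}<\infty$ for some $q\in\mathbb N_0$, with the inductive limit topology. Note $s\subset l_2\subset s'$ continuously. $L(s',s)$ is the Fréchet space of continuous linear operators $x:s'\to s$ with norms $\|x\|_q:=\sup_{|\xi|'_q\le1}|x\xi|_q$, $q\in\mathbb N_0$. Restriction to $l_2$ embeds $L(s',s)$ into the compact operators $K(l_2)$; an operator on $l_2$ ''belongs to $L(s',s)$'' if it is the restriction of an element of $L(s',s)$, and then $\|\cdot\|_q$ of it means the norm of that element. A projection is a continuous orthogonal (self-adjoint) projection on $l_2$; $P,Q$ are orthogonal if $PQ=0$. The spectral representation of a compact normal operator on $l_2$ is $x=\sum_n\lambda_nP_n$ with $\lambda_n$ nonzero pairwise different complex numbers, $|\lambda_1|\ge|\lambda_2|\ge\cdots$ (tending to zero if there are infinitely many), $P_n$ nonzero pairwise orthogonal finite dimensional projections, and the series convergent in operator norm (a finite sum if $x$ has finite rank). *)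

(* Defs.v *)
From HB Require Import structures.
From mathcomp Require Import all_boot all_order all_algebra.
From mathcomp Require Import complex.
From mathcomp Require Import all_classical all_reals all_analysis.
From mathcomp Require Import ring.

Set Implicit Arguments.
Unset Strict Implicit.
Unset Printing Implicit Defensive.

Import Order.TTheory GRing.Theory Num.Theory.
Import numFieldNormedType.Exports.
Import ComplexField.Normc.

Local Open Scope classical_set_scope.
Local Open Scope complex_scope.
Local Open Scope ring_scope.

(* Complex sequences (xi_j)_{j >= 1} are functions [xi : nat -> R[i]] with the
   index shifted by one: [xi j] is the (j+1)-th term. [normc] is the modulus
   as an element of [R], whereas the norm of [R[i]] as a numFieldType takes its
   values in [R[i]]. *)

Section weighted_norm.
Context {R : realType}.
Implicit Types (z : int) (xi eta : nat -> R[i]).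

(* |.|_q is [wnorm q%:Z], |.|'_q is [wnorm (- q%:Z)] and the norm of l_2 is
   [wnorm 0]; the value is +oo when the series diverges. *)
Definition wnorm z xi : \bar R :=
  sqrte (\sum_(0 <= j <oo) (normc (xi j) ^+ 2 * j.+1%:R ^ (2 * z))%:E)%E.

Let term z xi (j : nat) : \bar R := (normc (xi j) ^+ 2 * j.+1%:R ^ (2 * z))%:E.

Let w_ge0 z (j : nat) : 0 <= j.+1%:R ^ (2 * z) :> R.
Proof. by rewrite exprz_ge0. Qed.

Let term_ge0 z xi j : (0 <= term z xi j)%E.
Proof. by rewrite lee_fin mulr_ge0// sqr_ge0. Qed.

Let sum_ge0 z xi : (0 <= \sum_(0 <= j <oo) term z xi j)%E.
Proof. by apply: nneseries_ge0 => j _ _; exact: term_ge0. Qed.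

Lemma wnorm_ge0 z xi : (0 <= wnorm z xi)%E.
Proof. exact: sqrte_ge0. Qed.

Lemma wnorm0 z : wnorm z 0 = 0%E.
Proof.
rewrite /wnorm eseries0 ?sqrte0// => j _ _.
by rewrite (_ : normc _ = 0) ?expr0n/= ?mul0r//; exact: normc0.
Qed.

Lemma wnormZ z (c : R[i]) xi : wnorm z (c *: xi)%R = ((normc c)%:E * wnorm z xi)%E.
Proof.
have c0 : 0 <= normc c by case: c => a b; exact: sqrtr_ge0.
rewrite /wnorm (eq_eseriesr (g := fun j => ((normc c ^+ 2)%:E * term z xi j)%E)).
  rewrite nneseriesZl; last by move=> j _; exact: term_ge0.
  rewrite sqrteM ?lee_fin ?sqr_ge0//= sqrtr_sqr ger0_norm//.
by move=> j _; rewrite /term -EFinM (normcM c) exprMn -mulrA.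
Qed.

Let term_le z xi eta j (a b : R) : 0 < a -> 0 < b ->
  (term z (xi + eta)%R j <=
     (1 + b / a)%:E * term z xi j + (1 + a / b)%:E * term z eta j)%E.
Proof.
move=> a0 b0; rewrite /term -!EFinM -EFinD lee_fin !mulrA -mulrDl.
apply: ler_wpM2r; first exact: w_ge0.
have nge0 (c : R[i]) : 0 <= normc c by case: c => ? ?; exact: sqrtr_ge0.
set u := normc (xi j); set v := normc (eta j).
have uv : normc ((xi + eta) j) ^+ 2 <= (u + v) ^+ 2.
  by rewrite lerXn2r ?nnegrE ?addr_ge0 ?nge0// le_normcD.
apply: (le_trans uv); rewrite -subr_ge0.
have -> : (1 + b / a) * u * u + (1 + a / b) * v * v - (u + v) ^+ 2 =
    (b * u - a * v) ^+ 2 / (a * b).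
  by field; rewrite !gt_eqF.
by rewrite mulr_ge0 ?sqr_ge0// invr_ge0 mulr_ge0 ?ltW.
Qed.

Lemma wnormD z xi eta : (wnorm z (xi + eta)%R <= wnorm z xi + wnorm z eta)%E.
Proof.
have := wnorm_ge0 z xi; have := wnorm_ge0 z eta.
case Ea : (wnorm z xi) => [a| |]; case Eb : (wnorm z eta) => [b| |] //=;
  rewrite ?leey// !lee_fin => b0 a0.
have fin2 zeta (r : R) : wnorm z zeta = r%:E ->
    (\sum_(0 <= j <oo) term z zeta j)%E = (r ^+ 2)%:E.
  by move=> E; rewrite -[LHS]sqr_sqrte// -/(wnorm z zeta) E.
apply/lee_addgt0Pr => e e0.
pose a' := a + e / 2; pose b' := b + e / 2.
have a'0 : 0 < a' by rewrite ltr_wpDl// divr_gt0.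
have b'0 : 0 < b' by rewrite ltr_wpDl// divr_gt0.
have -> : (a%:E + b%:E + e%:E)%E = sqrte ((a' + b') ^+ 2)%:E.
  rewrite /= sqrtr_sqr ger0_norm; last by rewrite addr_ge0 ?ltW.
  by rewrite -!EFinD /a' /b'; congr EFin; field.
rewrite lee_sqrt ?lee_fin ?sqr_ge0//.
apply: (@le_trans _ _ ((1 + b' / a')%:E * (a ^+ 2)%:E +
                       (1 + a' / b')%:E * (b ^+ 2)%:E)%E).
  rewrite -(fin2 _ _ Ea) -(fin2 _ _ Eb).
  have ta : 0 <= 1 + b' / a' by rewrite addr_ge0// divr_ge0 ?ltW.
  have tb : 0 <= 1 + a' / b' by rewrite addr_ge0// divr_ge0 ?ltW.
  rewrite -!nneseriesZl//; try by move=> *; exact: term_ge0.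
  rewrite -nneseriesD; try by move=> *; apply: mule_ge0;
    [rewrite lee_fin|exact: term_ge0].
  by apply: lee_nneseries => [j _ _|j _]; [exact: term_ge0|exact: term_le].
rewrite -!EFinM -EFinD lee_fin.
have -> : (a' + b') ^+ 2 = (1 + b' / a') * a' ^+ 2 + (1 + a' / b') * b' ^+ 2.
  by field; rewrite !gt_eqF.
have leX (c c' : R) : 0 <= c -> c <= c' -> c ^+ 2 <= c' ^+ 2.
  by move=> c0 cc'; rewrite lerXn2r ?nnegrE// (le_trans c0).
apply: lerD; apply: ler_wpM2l; rewrite ?addr_ge0 ?divr_ge0 ?(ltW a'0) ?(ltW b'0)//.
  by apply: leX => //; rewrite lerDl divr_ge0 ?ltW.
by apply: leX => //; rewrite lerDl divr_ge0 ?ltW.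
Qed.

End weighted_norm.

Section sequence_spaces.
Variable R : realType.

Definition in_s : {pred nat -> R[i]} :=
  fun xi => `[< forall q : nat, (wnorm q%:Z xi < +oo)%E >].
Definition in_s' : {pred nat -> R[i]} :=
  fun xi => `[< exists q : nat, (wnorm (- q%:Z) xi < +oo)%E >].
Definition in_l2 : {pred nat -> R[i]} := fun xi => `[< (wnorm 0 xi < +oo)%E >].

Lemma wnormDZ_lty z (c : R[i]) (xi eta : nat -> R[i]) :
  (wnorm z xi < +oo -> wnorm z eta < +oo -> wnorm z (c *: xi + eta)%R < +oo)%E.
Proof.
move=> xioo etaoo; apply: le_lt_trans (wnormD _ _ _) _.
rewrite lte_add_pinfty// wnormZ lte_mul_pinfty ?lee_fin//.
by case: c => ? ?; exact: sqrtr_ge0.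
Qed.

Lemma le_wnorm z z' (xi : nat -> R[i]) :
  z <= z' -> (wnorm z xi <= wnorm z' xi)%E.
Proof.
move=> zz'; have ge0 t j : (0 <= (normc (xi j) ^+ 2 * j.+1%:R ^ t)%:E :> \bar R)%E.
  by rewrite lee_fin mulr_ge0 ?sqr_ge0// exprz_ge0.
rewrite lee_sqrt; last by apply: nneseries_ge0 => j _ _; exact: ge0.
apply: lee_nneseries => [j _ _|j _]; first exact: ge0.
rewrite lee_fin ler_wpM2l ?sqr_ge0// ler_weXz2l ?ler1n//.
by rewrite ler_pM2l.
Qed.

Lemma in_s_submod_closed : submod_closed in_s.
Proof.
split=> [|c xi eta]; first by apply/asboolP => q; rewrite wnorm0 ltry.
by move=> /asboolP xiq /asboolP etaq; apply/asboolP => q; exact: wnormDZ_lty.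
Qed.

Lemma in_s'_submod_closed : submod_closed in_s'.
Proof.
split=> [|c xi eta]; first by apply/asboolP; exists 0%N; rewrite wnorm0 ltry.
move=> /asboolP[p xip] /asboolP[q etaq]; apply/asboolP; exists (maxn p q).
apply: wnormDZ_lty; [apply: le_lt_trans xip|apply: le_lt_trans etaq];
  by apply: le_wnorm; rewrite lerN2 lez_nat ?leq_maxl ?leq_maxr.
Qed.

Lemma in_l2_submod_closed : submod_closed in_l2.
Proof.
split=> [|c xi eta]; first by apply/asboolP; rewrite wnorm0 ltry.
by move=> /asboolP xi0 /asboolP eta0; apply/asboolP; exact: wnormDZ_lty.
Qed.

HB.instance Definition _ := GRing.isSubmodClosed.Build _ _ in_s
  in_s_submod_closed.
HB.instance Definition _ := GRing.isSubmodClosed.Build _ _ in_s'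
  in_s'_submod_closed.
HB.instance Definition _ := GRing.isSubmodClosed.Build _ _ in_l2
  in_l2_submod_closed.

Record s_space := SSpace { s_val :> nat -> R[i] ; s_valP : s_val \in in_s }.
Record s'_space := S'Space { s'_val :> nat -> R[i] ; s'_valP : s'_val \in in_s' }.
Record l2_space := L2Space { l2_val :> nat -> R[i] ; l2_valP : l2_val \in in_l2 }.

HB.instance Definition _ := [isSub for s_val].
HB.instance Definition _ := [Choice of s_space by <:].
HB.instance Definition _ := [SubChoice_isSubLmodule of s_space by <:].

HB.instance Definition _ := [isSub for s'_val].
HB.instance Definition _ := [Choice of s'_space by <:].
HB.instance Definition _ := [SubChoice_isSubLmodule of s'_space by <:].

HB.instance Definition _ := [isSub for l2_val].
HB.instance Definition _ := [Choice of l2_space by <:].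
HB.instance Definition _ := [SubChoice_isSubLmodule of l2_space by <:].

End sequence_spaces.

Arguments in_s : clear implicits.
Arguments in_s' : clear implicits.
Arguments in_l2 : clear implicits.

Section l2_norm.
Context {R : realType}.
Implicit Types xi eta : l2_space R.

Definition l2_norm xi : R[i] := (fine (wnorm 0 xi))%:C.

Lemma l2_wnorm_fin xi : wnorm 0 xi \is a fin_num.
Proof. by rewrite ge0_fin_numE ?wnorm_ge0//; have /asboolP := l2_valP xi. Qed.

Lemma l2_fineK xi : (fine (wnorm 0 xi))%:E = wnorm 0 xi.
Proof. exact/fineK/l2_wnorm_fin. Qed.

Lemma l2_normD xi eta : l2_norm (xi + eta) <= l2_norm xi + l2_norm eta.
Proof.
rewrite /l2_norm -rmorphD/= lecR -lee_fin EFinD.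
rewrite (l2_fineK xi) (l2_fineK eta) (l2_fineK (xi + eta)).
exact: wnormD.
Qed.

Lemma l2_normZ (c : R[i]) xi : l2_norm (c *: xi) = `|c| * l2_norm xi.
Proof.
have cE : `|c| = (normc c)%:C by [].
rewrite /l2_norm cE -rmorphM/=; congr (_%:C).
by rewrite -[normc c]/(fine (normc c)%:E) -fineM ?l2_wnorm_fin// -wnormZ.
Qed.

Lemma l2_norm_eq0 xi : l2_norm xi = 0 -> xi = 0.
Proof.
move=> [xi0]; apply: val_inj; apply/funext => j /=; apply: eq0_normc.
have ge0 k : (0 <= (normc (xi k) ^+ 2 * k.+1%:R ^ (2 * 0))%:E :> \bar R)%E.
  by rewrite lee_fin mulr_ge0 ?sqr_ge0// exprz_ge0.
have /eqP : wnorm 0 xi = 0%E by rewrite -[LHS]fineK ?l2_wnorm_fin// xi0.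
rewrite -(@sqrte0 R) eq_le => /andP[+ _]; rewrite lee_sqrt// => sum_le0.
have := le_trans (nneseries_lim_ge j.+1 (fun k _ _ => ge0 k)) sum_le0.
rewrite big_nat_recr//= => h.
have : ((normc (xi j) ^+ 2 * j.+1%:R ^ (2 * 0))%:E <= 0 :> \bar R)%E.
  by apply: le_trans h; rewrite leeDr// sume_ge0.
rewrite lee_fin mulr0 expr0z mulr1 => h2.
by apply/eqP; rewrite -sqrf_eq0 eq_le h2 sqr_ge0.
Qed.

HB.instance Definition _ := @Lmodule_isNormed.Build R[i] (l2_space R)
  l2_norm l2_normD l2_normZ l2_norm_eq0.

End l2_norm.

(* The topology of a vector space E having the filter base B of sets as a base
   of neighbourhoods of 0. *)
Section vector_topology.
Context (E : zmodType) (B : set (set E)).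

Definition open_of_base0 : set (set E) :=
  [set O | forall x, O x -> exists2 U, B U & forall u, U u -> O (x + u)].

Hypothesis B_neq0 : B !=set0.
Hypothesis B_setI : forall U V, B U -> B V -> B (U `&` V).

Lemma open_of_base0T : open_of_base0 setT.
Proof. by move=> x _; have [U BU] := B_neq0; exists U. Qed.

Lemma open_of_base0I : setI_closed open_of_base0.
Proof.
move=> O O' Oo Oo' x [/Oo[U BU UO] /Oo'[V BV VO']].
by exists (U `&` V); [exact: B_setI|move=> u [/UO ? /VO' ?]].
Qed.

Lemma open_of_base0_bigU (I : Type) (f : I -> set E) :
  (forall i, open_of_base0 (f i)) -> open_of_base0 (\bigcup_i f i).
Proof.
move=> fo x [i _ /fo[U BU Uf]]; exists U => // u /Uf fu; by exists i.
Qed.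

End vector_topology.

Section topologies.
Variable R : realType.

(* 0-neighbourhoods for the norms (|.|_q)_q, which are nondecreasing in q. *)
Definition s_nbhs0 : set (set (s_space R)) :=
  [set U | exists q : nat, exists2 eps : R, 0 < eps &
    forall xi : s_space R, (wnorm q%:Z xi < eps%:E)%E -> U xi].

Lemma s_nbhs0_neq0 : s_nbhs0 !=set0.
Proof. by exists setT, 0%N, 1. Qed.

Lemma s_nbhs0I U V : s_nbhs0 U -> s_nbhs0 V -> s_nbhs0 (U `&` V).
Proof.
move=> [p [d d0 dU]] [q [e e0 eV]]; exists (maxn p q), (Num.min d e).
  by rewrite lt_min d0.
move=> xi; rewrite EFin_min lt_min => /andP[xid xie]; split.
  by apply/dU/le_lt_trans/xid/le_wnorm; rewrite lez_nat leq_maxl.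
by apply/eV/le_lt_trans/xie/le_wnorm; rewrite lez_nat leq_maxr.
Qed.

HB.instance Definition _ := @isOpenTopological.Build (s_space R)
  (open_of_base0 s_nbhs0) (open_of_base0T s_nbhs0_neq0)
  (open_of_base0I s_nbhs0I) (@open_of_base0_bigU _ s_nbhs0).

(* Locally convex inductive limit of the normed spaces
   {xi | |xi|'_q < +oo}: a base of 0-neighbourhoods is given by the absolutely
   convex sets whose trace on each of these spaces is a 0-neighbourhood. *)
Definition absolutely_convex (E : lmodType R[i]) (U : set E) : Prop :=
  forall (a b : R[i]) x y, `|a| + `|b| <= 1 -> U x -> U y -> U (a *: x + b *: y).

Definition s'_base0 : set (set (s'_space R)) :=
  [set U | absolutely_convex U /\ forall q : nat, exists2 eps : R, 0 < eps &
    forall xi : s'_space R, (wnorm (- q%:Z) xi < eps%:E)%E -> U xi].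

Lemma s'_base0_neq0 : s'_base0 !=set0.
Proof. by exists setT; split=> // q; exists 1. Qed.

Lemma s'_base0I U V : s'_base0 U -> s'_base0 V -> s'_base0 (U `&` V).
Proof.
move=> [cU bU] [cV bV]; split=> [a b x y ab [Ux Vx] [Uy Vy]|q].
  by split; [exact: cU|exact: cV].
have [d d0 dU] := bU q; have [e e0 eV] := bV q.
exists (Num.min d e); first by rewrite lt_min d0.
by move=> xi; rewrite EFin_min lt_min => /andP[/dU ? /eV ?].
Qed.

HB.instance Definition _ := @isOpenTopological.Build (s'_space R)
  (open_of_base0 s'_base0) (open_of_base0T s'_base0_neq0)
  (open_of_base0I s'_base0I) (@open_of_base0_bigU _ s'_base0).

End topologies.

Section inclusions.
Context {R : realType}.

Lemma s_sub_l2 (xi : s_space R) : s_val xi \in in_l2 R.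
Proof. by apply/asboolP; have /asboolP/(_ 0%N) := s_valP xi. Qed.

Lemma l2_sub_s' (xi : l2_space R) : l2_val xi \in in_s' R.
Proof. by apply/asboolP; exists 0%N; rewrite oppr0; have /asboolP := l2_valP xi. Qed.

Definition s_to_l2 (xi : s_space R) : l2_space R := L2Space (s_sub_l2 xi).
Definition l2_to_s' (xi : l2_space R) : s'_space R := S'Space (l2_sub_s' xi).

End inclusions.

Section operators.
Context {R : realType}.

Record Lss := MkLss {
  Lss_fun :> {linear s'_space R -> s_space R} ;
  Lss_continuous : continuous Lss_fun }.

Definition Lss_norm (q : nat) (X : Lss) : \bar R :=
  ereal_sup [set wnorm q%:Z (X xi) | xi in
    [set xi : s'_space R | (wnorm (- q%:Z) xi <= 1)%E]].

Definition restrict_l2 (X : Lss) : l2_space R -> l2_space R :=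
  fun xi => s_to_l2 (X (l2_to_s' xi)).

Implicit Types (x y P : {linear l2_space R -> l2_space R}).

Definition in_Lss x : Prop := exists X : Lss, x =1 restrict_l2 X.

(* Norm of the element of L(s',s) extending [x], which is unique when it exists
   as l_2 is dense in s'; 0 when [x] does not belong to L(s',s). *)
Definition Lss_norm_l2 (q : nat) x : \bar R :=
  xget 0%E [set r | exists2 X : Lss, x =1 restrict_l2 X & r = Lss_norm q X].

(* <xi, eta>, linear in [xi]; [R[i]^o] carries the topology of [R[i]] *)
Definition inner (xi eta : l2_space R) : R[i] :=
  limn (fun n => (\sum_(0 <= j < n) xi j * (eta j)^*%R : R[i]^o)).

Definition adjoint x y : Prop := forall xi eta, inner (x xi) eta = inner xi (y eta).

Definition normal_op x : Prop :=
  continuous x /\ exists y, [/\ continuous y, adjoint x y & x \o y =1 y \o x].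

Definition compact_op x : Prop :=
  precompact (x @` [set xi : l2_space R | `|xi| <= 1]).

Definition finite_rank x : Prop :=
  exists (k : nat) (e : 'I_k -> l2_space R), forall xi,
    exists a : 'I_k -> R[i], x xi = \sum_(i < k) a i *: e i.

Definition projection P : Prop :=
  [/\ continuous P, P \o P =1 P & adjoint P P].

Definition op_norm (T : l2_space R -> l2_space R) : \bar R :=
  ereal_sup [set wnorm 0 (T xi) | xi in
    [set xi : l2_space R | (wnorm 0 xi <= 1)%E]].

(* The conditions on the eigenvalues and projections of a spectral
   representation whose set of indices is [D]. *)
Definition spectral_family (D : set nat) (lam : nat -> R[i])
    (P : nat -> {linear l2_space R -> l2_space R}) : Prop :=
  [/\ forall n, D n -> lam n != 0,
      forall m n, D m -> D n -> lam m = lam n -> m = n,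
      forall m n, D m -> D n -> (m <= n)%N -> normc (lam n) <= normc (lam m),
      forall n, D n ->
        [/\ projection (P n), finite_rank (P n) & exists xi, P n xi != 0] &
      forall m n, D m -> D n -> m <> n -> forall xi, P m (P n xi) = 0].

Definition infinite_spectral_rep x (lam : nat -> R[i])
    (P : nat -> {linear l2_space R -> l2_space R}) : Prop :=
  [/\ spectral_family setT lam P,
      normc (lam n) @[n --> \oo] --> (0 : R) &
      op_norm (fun xi => x xi - \sum_(0 <= n < N) lam n *: P n xi)
        @[N --> \oo] --> 0%E].

Definition finite_spectral_rep (N : nat) x (lam : nat -> R[i])
    (P : nat -> {linear l2_space R -> l2_space R}) : Prop :=
  spectral_family `I_N lam P /\
  forall xi, x xi = \sum_(0 <= n < N) lam n *: P n xi.

End operators.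

(* Main.v *)
(** Write |.|'_q for the dual norms. A bounded operator x on l_2 belongs to
    L(s',s) iff for every q one has |x xi|_q <= C_q |xi|'_q on l_2, and ||x||_q
    is the least such C_q. For an orthogonal projection P in L(s',s), duality
    gives |P xi|_{2q} <= ||P||_{2q}^{1/2} |P xi|_0; together with the convexity
    |eta|_q^2 <= |eta|_0 |eta|_{2q} and |P xi|_0^2 = <P xi, xi>, this yields
    ||P||_q^2 <= ||P||_{2q}.

    If x is in L(s',s), then x P_n = lambda_n P_n implies
    ||P_n||_q <= (C_q / |lambda_n|)^2, and iterating the previous inequality
    makes the exponent of 1 / |lambda_n| as small as desired. The sequence
    (lambda_n) is rapidly decreasing because a nonzero combination of n + 1
    eigenvectors can be chosen with n vanishing coordinates. This is (i) => (ii).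
    For (iii) => (iv), (|lambda_n| ||P_n||_q)^2 is at most
    |lambda_n| (|lambda_n| ||P_n||_{2q}), a rapidly decreasing sequence. *)

Require Import Defs.
From HB Require Import structures.
From mathcomp Require Import all_boot all_order all_algebra.
From mathcomp Require Import complex.
From mathcomp Require Import all_classical all_reals all_analysis.
From mathcomp Require Import ring lra.

Import Order.TTheory GRing.Theory Num.Theory.
Import numFieldNormedType.Exports.
Import ComplexField.Normc.

Local Open Scope classical_set_scope.
Local Open Scope complex_scope.
Local Open Scope ring_scope.

(** * Limits and absolutely convergent series of complex numbers *)

Section complex_limits.
Context {R : realType}.
Implicit Types (z : R[i]) (u f g : nat -> R[i]).

Lemma normc_ge0 z : 0 <= normc z.
Proof. by case: z => a b; exact: sqrtr_ge0. Qed.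

Lemma normrcE z : `|z| = (normc z)%:C.
Proof. by []. Qed.

Lemma normc_conj z : normc z^*%R = normc z.
Proof. by case: z => a b; rewrite /normc /= sqrrN. Qed.

Lemma normc_real (a : R) : normc a%:C = `|a|.
Proof. by rewrite /normc /= expr0n addr0 sqrtr_sqr. Qed.

Lemma mulc_conj z : z * z^*%R = (normc z ^+ 2)%:C.
Proof.
by rewrite -normCK normrcE rmorphXn.
Qed.

Lemma normc_sum (n : nat) f :
  normc (\sum_(0 <= j < n) f j) <= \sum_(0 <= j < n) normc (f j).
Proof.
by rewrite -lecR -normrcE rmorph_sum/=; exact: ler_norm_sum.
Qed.

(** The norm of [R[i]] takes its values in [R[i]]; passing to the real modulus makes squeeze and
    comparison arguments in [R] available. *)
Lemma cvg_normcP u z :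
  (u n : R[i]^o) @[n --> \oo] --> (z : R[i]^o) <->
  normc (z - u n) @[n --> \oo] --> (0 : R).
Proof.
split=> [/cvgrPdist_lt uz | uz].
  apply/cvgrPdist_lt => e e0; have e0' : 0 < e%:C by rewrite ltcR.
  apply: filterS (uz _ e0') => n; rewrite normrcE ltcR.
  by rewrite sub0r normrN ger0_norm// normc_ge0.
(* A positive element of [R[i]] has zero imaginary part, so the tolerance [e] is real. *)
apply/cvgrPdist_lt => e e0; move: (e0); rewrite ltcE => /andP[/eqP e_im e_re].
have eE : e = (complex.Re e)%:C by case: e e_im {e0 e_re} => a b /= ->.
move/cvgrPdist_lt: uz => /(_ _ e_re); apply: filterS => n.
by rewrite sub0r normrN ger0_norm ?normc_ge0// eE normrcE ltcR.
Qed.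

Lemma cvg_normc u z :
  (u n : R[i]^o) @[n --> \oo] --> (z : R[i]^o) ->
  normc (u n) @[n --> \oo] --> normc z.
Proof.
move=> /cvg_normcP /cvgrPdist_lt uz; apply/cvgrPdist_lt => e e0.
apply: filterS (uz e e0) => n; rewrite sub0r normrN ger0_norm ?normc_ge0//.
apply: le_lt_trans; rewrite -lecR -[leRHS]normrcE -normc_real.
rewrite -normrcE rmorphB/= -(normrcE z) -(normrcE (u n)).
exact: ler_dist_dist.
Qed.

Lemma cvg_conjc u z :
  (u n : R[i]^o) @[n --> \oo] --> (z : R[i]^o) ->
  ((u n)^*%R : R[i]^o) @[n --> \oo] --> (z^*%R : R[i]^o).
Proof.
move=> /cvg_normcP uz; apply/cvg_normcP.
by under eq_fun do rewrite -rmorphB normc_conj.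
Qed.

Lemma cvg_realc (v : nat -> R) (a : R) :
  v n @[n --> \oo] --> a -> ((v n)%:C : R[i]^o) @[n --> \oo] --> (a%:C : R[i]^o).
Proof.
move=> /cvgrPdist_lt va; apply/cvg_normcP/cvgrPdist_lt => e e0.
apply: filterS (va e e0) => n.
by rewrite -rmorphB normc_real sub0r normrN normr_id.
Qed.

Lemma is_cvg_sumr (v : nat -> R) (M : R) :
  (forall n, \sum_(0 <= j < n) `|v j| <= M) ->
  cvgn (fun n => \sum_(0 <= j < n) v j).
Proof.
move=> vM; apply: (@normed_cvg _ R^o).
apply: nondecreasing_is_cvgn; first by apply: nondecreasing_series => *; exact: normr_ge0.
by exists M => _ [n _ <-]; exact: vM.
Qed.

(** Real and imaginary parts are dominated by the modulus, so both real series converge absolutely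
    and their limits recombine. *)
Lemma is_cvg_sumc f (M : R) : (forall n, \sum_(0 <= j < n) normc (f j) <= M) ->
  cvgn (fun n => \sum_(0 <= j < n) f j : R[i]^o).
Proof.
move=> fM.
have leRe z : `|complex.Re z| <= normc z.
  by case: z => a b /=; rewrite -sqrtr_sqr ler_wsqrtr// lerDl sqr_ge0.
have leIm z : `|complex.Im z| <= normc z.
  by case: z => a b /=; rewrite -sqrtr_sqr ler_wsqrtr// lerDr sqr_ge0.
have cRe : cvgn (fun n => \sum_(0 <= j < n) complex.Re (f j)).
  by apply: (@is_cvg_sumr _ M) => n; apply: le_trans (fM n); exact: ler_sum.
have cIm : cvgn (fun n => \sum_(0 <= j < n) complex.Im (f j)).
  by apply: (@is_cvg_sumr _ M) => n; apply: le_trans (fM n); exact: ler_sum.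
have -> : (fun n => \sum_(0 <= j < n) f j : R[i]^o) =
    (fun n => (\sum_(0 <= j < n) complex.Re (f j))%:C +
              'i * (\sum_(0 <= j < n) complex.Im (f j))%:C : R[i]^o).
  apply/funext => n; rewrite !rmorph_sum mulr_sumr -big_split /=.
  by apply: eq_bigr => j _; rewrite [LHS]complexE.
apply/cvg_ex; eexists; apply: cvgD; first exact: cvg_realc cRe.
apply: cvgMr; exact: cvg_realc cIm.
Qed.

End complex_limits.

(** * Weighted norms through real partial sums, and Cauchy-Schwarz *)

Section weighted_norms.
Context {R : realType}.
Implicit Types (z : int) (xi eta : nat -> R[i]).

Definition weight z (j : nat) : R := j.+1%:R ^ (2 * z).

Lemma weight_gt0 z j : 0 < weight z j.
Proof. by rewrite exprz_gt0. Qed.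

Lemma weightD z z' j : weight (z + z') j = weight z j * weight z' j.
Proof. by rewrite /weight mulrDr expfzDr. Qed.

Lemma weight0 j : weight 0 j = 1.
Proof. by rewrite /weight mulr0 expr0z. Qed.

Definition wsum z xi (k : nat) : R :=
  \sum_(0 <= j < k) normc (xi j) ^+ 2 * weight z j.

Let wterm_ge0 z xi j : 0 <= normc (xi j) ^+ 2 * weight z j.
Proof. by rewrite mulr_ge0 ?sqr_ge0// ltW ?weight_gt0. Qed.

Lemma wsum_ge0 z xi k : 0 <= wsum z xi k.
Proof. by apply: sumr_ge0 => *; exact: wterm_ge0. Qed.

Lemma wnorm_sqr_sum z xi :
  (wnorm z xi ^+ 2 = \sum_(0 <= j <oo) (normc (xi j) ^+ 2 * weight z j)%:E)%E.
Proof.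
rewrite sqr_sqrte//; apply: nneseries_ge0 => j _ _.
by rewrite lee_fin; exact: wterm_ge0.
Qed.

Lemma wsum_le_sqr_wnorm z xi k : ((wsum z xi k)%:E <= wnorm z xi ^+ 2)%E.
Proof.
rewrite wnorm_sqr_sum -sumEFin; apply: nneseries_lim_ge => j _ _.
exact: wterm_ge0.
Qed.

(** The terms are nonnegative, so the series is the supremum of its partial sums; extended real
    estimates become finite real ones. *)
Lemma wnorm_leP z xi (C : R) : 0 <= C ->
  (wnorm z xi <= C%:E)%E <-> forall k, wsum z xi k <= C ^+ 2.
Proof.
move=> C0; split=> [xiC k|xiC].
  rewrite -lee_fin; apply: le_trans (wsum_le_sqr_wnorm _ _ _) _.
  by rewrite EFin_expe !expe2 lee_pmul ?wnorm_ge0.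
have -> : C%:E = sqrte (C ^+ 2)%:E by rewrite /= sqrtr_sqr ger0_norm.
rewrite lee_sqrt ?lee_fin ?sqr_ge0//.
apply: lime_le; first by apply: is_cvg_nneseries => j _ _; exact: wterm_ge0.
by apply: nearW => k; rewrite sumEFin lee_fin; exact: xiC.
Qed.

Lemma wnorm_le_scale z z' xi eta (c : R) : 0 <= c ->
  (forall j, normc (xi j) ^+ 2 * weight z j <=
             c ^+ 2 * (normc (eta j) ^+ 2 * weight z' j)) ->
  (wnorm z xi <= c%:E * wnorm z' eta)%E.
Proof.
move=> c0 xieta; rewrite {2}/wnorm.
have -> : c%:E = sqrte (c ^+ 2)%:E by rewrite /= sqrtr_sqr ger0_norm.
rewrite -sqrteM ?lee_fin ?sqr_ge0// -nneseriesZl; last first.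
  by move=> j _; exact: wterm_ge0.
rewrite lee_sqrt; last first.
  by apply: nneseries_ge0 => j _ _; rewrite mule_ge0 ?lee_fin ?sqr_ge0//; exact: wterm_ge0.
apply: lee_nneseries => j *; first exact: wterm_ge0.
by rewrite -EFinM lee_fin; exact: xieta.
Qed.

(** [fine] sends [+oo] to 0, so this is the norm only where [wnorm] is finite. *)
Definition nrm z xi : R := fine (wnorm z xi).

Lemma nrm_ge0 z xi : 0 <= nrm z xi.
Proof. exact: fine_ge0 (wnorm_ge0 _ _). Qed.

Lemma nrmE z xi : (wnorm z xi < +oo)%E -> wnorm z xi = (nrm z xi)%:E.
Proof. by move=> xioo; rewrite fineK// ge0_fin_numE// wnorm_ge0. Qed.

Lemma wsum_cvg z xi : (wnorm z xi < +oo)%E ->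
  wsum z xi k @[k --> \oo] --> nrm z xi ^+ 2.
Proof.
move=> xioo; suff /fine_cvg : (wsum z xi k)%:E @[k --> \oo] --> (nrm z xi ^+ 2)%:E by [].
rewrite EFin_expe -nrmE// wnorm_sqr_sum.
under eq_fun do rewrite -sumEFin.
by apply: is_cvg_nneseries => j _ _; exact: wterm_ge0.
Qed.

Lemma wsum_le_nrm z xi k : (wnorm z xi < +oo)%E ->
  wsum z xi k <= nrm z xi ^+ 2.
Proof. by move=> xioo; rewrite -lee_fin EFin_expe -nrmE// wsum_le_sqr_wnorm. Qed.

(** Induction on [k]: the new cross term satisfies $2 s a_k b_k \le A b_k^2 + B a_k^2$, because $s^2
    \le AB$ by induction and $4AB a_k^2 b_k^2 \le (A b_k^2 + B a_k^2)^2$. *)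
Lemma sumr_cauchy_schwarz (a b : nat -> R) (k : nat) :
  (\sum_(0 <= j < k) a j * b j) ^+ 2 <=
  (\sum_(0 <= j < k) a j ^+ 2) * (\sum_(0 <= j < k) b j ^+ 2).
Proof.
elim: k => [|k IHk]; first by rewrite !big_geq// expr0n mul0r.
rewrite !big_nat_recr//=.
set s := \sum_(0 <= j < k) a j * b j in IHk *.
set A := \sum_(0 <= j < k) a j ^+ 2 in IHk *.
set B := \sum_(0 <= j < k) b j ^+ 2 in IHk *.
have A0 : 0 <= A by apply: sumr_ge0 => j _; exact: sqr_ge0.
have B0 : 0 <= B by apply: sumr_ge0 => j _; exact: sqr_ge0.
have cross : 2 * (s * (a k * b k)) <= A * b k ^+ 2 + B * a k ^+ 2.
  have rhs0 : 0 <= A * b k ^+ 2 + B * a k ^+ 2.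
    by rewrite addr_ge0// mulr_ge0// sqr_ge0.
  apply: le_trans (ler_norm _) _; rewrite -(ger0_norm rhs0) -ler_sqr ?nnegrE//.
  rewrite !real_normK ?num_real//.
  have := sqr_ge0 (A * b k ^+ 2 - B * a k ^+ 2).
  have : s ^+ 2 * (a k * b k) ^+ 2 <= A * B * (a k * b k) ^+ 2.
    by rewrite ler_wpM2r ?sqr_ge0.
  by rewrite !expr2; nra.
by rewrite !expr2 in IHk cross *; nra.
Qed.

(** The choice $z' = -z$ gives the duality of $|\cdot|_z$ and $|\cdot|_{-z}$; the choice $z = 0$,
    $z' = 2q$ with [xi = eta] gives the convexity of the norms. *)
Lemma wsum_cauchy_schwarz z z' xi eta (k : nat) :
  (wnorm z xi < +oo)%E -> (wnorm z' eta < +oo)%E ->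
  \sum_(0 <= j < k) normc (xi j) * normc (eta j) * j.+1%:R ^ (z + z') <=
  nrm z xi * nrm z' eta.
Proof.
move=> xioo etaoo; set s := \sum_(0 <= j < k) _.
have s0 : 0 <= s.
  by apply: sumr_ge0 => j _; rewrite !mulr_ge0 ?normc_ge0// exprz_ge0.
have sqr_weight y j : (j.+1%:R ^ y : R) ^+ 2 = weight y j.
  by rewrite /weight mulrC -exprz_exp.
rewrite -ler_sqr ?nnegrE ?mulr_ge0 ?nrm_ge0// exprMn.
have := @sumr_cauchy_schwarz (fun j => normc (xi j) * j.+1%:R ^ z)
  (fun j => normc (eta j) * j.+1%:R ^ z') k.
have -> : \sum_(0 <= j < k) normc (xi j) * j.+1%:R ^ z *
    (normc (eta j) * j.+1%:R ^ z') = s.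
  by apply: eq_bigr => j _; rewrite expfzDr//; ring.
move=> /le_trans; apply; rewrite ler_pM ?sumr_ge0//.
- by move=> j _; exact: sqr_ge0.
- by move=> j _; exact: sqr_ge0.
- apply: le_trans (wsum_le_nrm z xi k xioo).
  by rewrite /wsum; apply: ler_sum => j _; rewrite exprMn sqr_weight.
- apply: le_trans (wsum_le_nrm z' eta k etaoo).
  by rewrite /wsum; apply: ler_sum => j _; rewrite exprMn sqr_weight.
Qed.

End weighted_norms.

(** * Coordinatewise limits and truncated sequences *)

Section coordinatewise_limits.
Context {R : realType}.
Implicit Types (z : int) (xi eta : nat -> R[i]) (u : nat -> nat -> R[i]).

(** This convergence follows from convergence in any single weighted norm, has unique limits and
    preserves upper bounds in all weighted norms; it serves to identify limits taken in different
    spaces. *)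
Definition coord_cvg u xi : Prop :=
  forall j, (u n j : R[i]^o) @[n --> \oo] --> (xi j : R[i]^o).

Lemma coord_cvg_unique u xi eta :
  coord_cvg u xi -> coord_cvg u eta -> xi = eta.
Proof.
move=> uxi ueta; apply/funext => j.
exact: (cvg_unique _ (uxi j) (ueta j)).
Qed.

(** A form of Fatou's lemma: each partial sum involves finitely many coordinates, so its bound
    passes to the limit. *)
Lemma wnorm_lim z u xi (C : R) :
  (forall n, (wnorm z (u n) <= C%:E)%E) -> coord_cvg u xi ->
  (wnorm z xi <= C%:E)%E.
Proof.
move=> uC uxi.
have C0 : 0 <= C by rewrite -lee_fin (le_trans (wnorm_ge0 z (u 0%N))).
apply/wnorm_leP => // k.
have uk : wsum z (u n) k @[n --> \oo] --> wsum z xi k.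
  apply: cvg_big => [|j _]; first exact: add_continuous.
  apply: cvgM; last exact: cvg_cst.
  rewrite expr2; under eq_fun do rewrite expr2.
  by apply: cvgM; apply: cvg_normc; exact: uxi.
rewrite -(cvg_lim _ uk)//; apply: limr_le; first by apply/cvg_ex; eexists; exact: uk.
by apply: nearW => n; move: k {uk}; apply/wnorm_leP.
Qed.

Lemma normc_coord_le z xi j (C : R) : 0 <= C -> (wnorm z xi <= C%:E)%E ->
  normc (xi j) <= C * j.+1%:R ^ (- z).
Proof.
move=> C0 xiC.
rewrite -ler_sqr ?nnegrE ?normc_ge0 ?mulr_ge0 ?exprz_ge0//.
have /(_ j.+1) := (wnorm_leP z xi C C0).1 xiC.
rewrite /wsum big_nat_recr//= => h.
have {h} : normc (xi j) ^+ 2 * weight z j <= C ^+ 2.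
  by apply: le_trans h; rewrite lerDr; exact: wsum_ge0.
rewrite -ler_pdivlMr ?weight_gt0// => /le_trans; apply.
rewrite exprMn ler_wpM2l ?sqr_ge0// /weight exprnP exprz_exp.
by rewrite mulNr [z * _]mulrC invr_expz.
Qed.

Lemma coord_cvg_wnorm z u xi (e : nat -> R) : (forall n, 0 <= e n) ->
  (forall n, (wnorm z (xi - u n)%R <= (e n)%:E)%E) ->
  e n @[n --> \oo] --> 0 -> coord_cvg u xi.
Proof.
move=> e0 ue ecvg j; apply/cvg_normcP.
apply: (@squeeze_cvgr _ _ _ _ (fun=> 0) (fun n => e n * j.+1%:R ^ (- z))).
- apply: nearW => n; rewrite normc_ge0/=.
  exact: (@normc_coord_le z (xi - u n) j (e n) (e0 n) (ue n)).
- exact: cvg_cst.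
- by rewrite -[X in _ --> X](mul0r (j.+1%:R ^ (- z))); apply: cvgM => //; exact: cvg_cst.
Qed.

Definition trunc (k : nat) xi (j : nat) : R[i] := if (j < k)%N then xi j else 0.

Lemma wnorm_trunc z k xi : (wnorm z (trunc k xi) <= wnorm z xi)%E.
Proof.
rewrite -[leRHS]mul1e; apply: wnorm_le_scale => // j.
rewrite expr1n mul1r ler_wpM2r ?(ltW (weight_gt0 _ _))// /trunc.
by case: ifP => // _; rewrite normc0 expr0n sqr_ge0.
Qed.

(** For $j < k$ one has $(j+1)^{2p} \le k^{2p}$. Hence truncations of elements of $s'$ lie in
    $l_2$. *)
Lemma wnorm_trunc0 (p k : nat) xi :
  (wnorm 0 (trunc k xi) <= (k%:R ^+ p)%:E * wnorm (- p%:Z) xi)%E.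
Proof.
apply: wnorm_le_scale => [|j]; first exact: exprn_ge0.
rewrite weight0 mulr1 /trunc; case: ifP => [jk|_]; last first.
  by rewrite normc0 expr0n mulr_ge0 ?sqr_ge0// mulr_ge0 ?sqr_ge0// ltW ?weight_gt0.
rewrite mulrCA ler_peMr ?sqr_ge0// /weight mulrN -invr_expz -exprM mulnC.
by rewrite ler_pdivlMr ?exprz_gt0// mul1r lerXn2r ?nnegrE ?ler_nat.
Qed.

(** The tail lives on indices $j \ge k$, where lowering the order by $m$ gains the factor
    $(j+1)^{-m} \le (k+1)^{-m}$. *)
Lemma wnorm_sub_trunc z (m k : nat) xi :
  (wnorm (z - m%:Z) (xi - trunc k xi)%R <= (k.+1%:R ^- m)%:E * wnorm z xi)%E.
Proof.
apply: wnorm_le_scale => [|j]; first by rewrite invr_ge0 exprn_ge0.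
have -> : (xi - trunc k xi) j = if (j < k)%N then 0 else xi j.
  transitivity (xi j - trunc k xi j) => //; rewrite /trunc.
  by case: ifP => _; rewrite ?subrr ?subr0.
case: ltnP => [_|kj].
  by rewrite normc0 expr0n mul0r mulr_ge0 ?sqr_ge0// mulr_ge0 ?sqr_ge0// ltW ?weight_gt0.
rewrite weightD mulrA mulrC ler_wpM2r//.
  by rewrite mulr_ge0 ?sqr_ge0// ltW ?weight_gt0.
rewrite /weight mulrN -invr_expz exprVn -exprM mulnC.
by rewrite lef_pV2 ?posrE ?exprn_gt0// ?exprz_gt0// lerXn2r ?nnegrE ?ler_nat.
Qed.

Lemma sum_inv_sqr_le (n : nat) : \sum_(0 <= j < n) (j.+1%:R ^- 2 : R) <= 2.
Proof.
(* The bound is strengthened for the induction: $(t+1)^{-2} \le t^{-1} - (t+1)^{-1}$ telescopes. *)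
suff : \sum_(0 <= j < n.+1) (j.+1%:R ^- 2 : R) <= 2 - n.+1%:R^-1.
  rewrite big_nat_recr//= => h.
  have h1 : 0 <= n.+1%:R ^- 2 :> R by rewrite invr_ge0 exprn_ge0.
  apply: (@le_trans _ _ (2 - n.+1%:R^-1)); last by rewrite gerBl.
  by apply: le_trans h; rewrite lerDl.
elim: n => [|n IHn]; first by rewrite big_nat1 expr1n; lra.
rewrite big_nat_recr//=; apply: (le_trans (lerD IHn (lexx _))).
have telescope (t : R) : 0 < t ->
    2 - (t + 1)^-1 - (2 - t^-1 + (t + 1) ^- 2) = (t * (t + 1) ^+ 2)^-1.
  by move=> t0; field; rewrite !gt_eqF// addr_gt0.
by rewrite -subr_ge0 -[n.+2%:R]natr1 telescope.
Qed.

End coordinatewise_limits.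

(** * Continuous operators from $s'$ to $s$ as families of norm bounds *)

Section smooth_operators.
Context {R : realType}.
Implicit Types (x y : {linear l2_space R -> l2_space R}) (X : @Lss R) (q : nat).

Lemma homogeneous_bound (E : lmodType R[i]) (N1 N2 : E -> \bar R) (d C : R) :
  (forall v, (0 <= N1 v)%E) -> (forall v, (0 <= N2 v)%E) ->
  (forall c v, N1 (c *: v) = ((normc c)%:E * N1 v)%E) ->
  (forall c v, N2 (c *: v) = ((normc c)%:E * N2 v)%E) ->
  0 < d -> 0 <= C ->
  (forall v, (N2 v < d%:E -> N1 v <= C%:E)%E) ->
  forall v, (N2 v < +oo -> N1 v <= (C / d)%:E * N2 v)%E.
Proof.
move=> N1_ge0 N2_ge0 N1Z N2Z d0 C0 N12 v N2v.
have N2vE : N2 v = (fine (N2 v))%:E by rewrite fineK// ge0_fin_numE.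
have r0 : 0 <= fine (N2 v) by exact: fine_ge0.
rewrite N2vE; set r := fine (N2 v) in N2vE r0 *.
apply/lee_addgt0Pr => e e0.
(* The slack [t] is positive, so that $N_2(v) = 0$ is covered, and its contribution $tC/d =
   eC/(C+1)$ is at most $e$. *)
pose t := e * d / (C + 1).
have t0 : 0 < t by rewrite divr_gt0 ?mulr_gt0 ?ltr_wpDl.
have rt0 : 0 < r + t by rewrite ltr_wpDl.
pose c := d / (r + t).
have c0 : 0 < c by rewrite divr_gt0.
have /N12 : (N2 (c%:C *: v) < d%:E)%E.
  rewrite N2Z normc_real gtr0_norm// N2vE -EFinM lte_fin /c mulrAC.
  by rewrite ltr_pdivrMr// ltr_pM2l// ltrDl.
rewrite N1Z normc_real gtr0_norm// -lee_pdivlMl// => /le_trans; apply.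
rewrite -!EFinM -EFinD lee_fin /c invf_div.
have -> : (r + t) / d * C = C / d * r + e * (C / (C + 1)).
  by rewrite /t; field; rewrite !gt_eqF// ltr_wpDl.
by rewrite lerD2l ler_piMr ?(ltW e0)// ler_pdivrMr ?ltr_wpDl// mul1r lerDl.
Qed.

(** Continuity at 0 yields a neighbourhood of 0 in $s'$ mapped into the unit ball of $|\cdot|_q$;
    its trace on the step of order $q$ contains a ball of radius [d], and homogeneity turns this
    into a bound. *)
Lemma Lss_bounded X q : exists2 M : R, 0 <= M &
  forall xi : s'_space R, (wnorm (- q%:Z) xi < +oo ->
    wnorm q%:Z (X xi) <= M%:E * wnorm (- q%:Z) xi)%E.
Proof.
pose V := [set eta : s_space R | (wnorm q%:Z eta < 1%:E)%E].
have Vo : open V.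
  move=> eta etaV; have etaE := nrmE _ _ (lt_trans etaV (ltry 1)).
  exists [set zeta : s_space R | (wnorm q%:Z zeta < (1 - nrm q%:Z eta)%:E)%E].
    exists q, (1 - nrm q%:Z eta) => //.
    by rewrite subr_gt0 -lte_fin -etaE.
  move=> zeta /= zetaV; apply: le_lt_trans (wnormD _ _ _) _.
  by rewrite etaE -lteBrDl// -EFinB.
have /continuousP/(_ _ Vo)/(_ 0) [] := @Lss_continuous _ X.
  by rewrite /V /= raddf0 wnorm0 lte01.
move=> U [_ /(_ q)[d d0 dU]] UV.
exists (1 / d); first by rewrite divr_ge0// ltW.
apply: (@homogeneous_bound (s'_space R) (fun xi => wnorm q%:Z (X xi))
  (fun xi => wnorm (- q%:Z) xi)) => //.
- by move=> v; exact: wnorm_ge0.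
- by move=> v; exact: wnorm_ge0.
- by move=> c v; rewrite linearZ; exact: wnormZ.
- by move=> c v; exact: wnormZ.
- by move=> v /dU /UV; rewrite /V /= add0r => /ltW.
Qed.

(** The bound is tested on $l_2$ only, so it makes sense before any extension to $s'$ is known. *)
Definition smooth_bound q (C : R) (x : l2_space R -> l2_space R) : Prop :=
  forall xi, (wnorm q%:Z (x xi) <= C%:E * wnorm (- q%:Z) xi)%E.

Lemma trunc_l2_subproof k (xi : s'_space R) : trunc k xi \in in_l2 R.
Proof.
have /asboolP[p xip] := s'_valP xi; apply/asboolP.
apply: le_lt_trans (wnorm_trunc0 p k xi) _.
by rewrite nrmE// -EFinM ltry.
Qed.

Definition trunc_l2 k (xi : s'_space R) : l2_space R :=
  L2Space (trunc_l2_subproof k xi).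

Lemma trunc_l2_linear k : linear (trunc_l2 k).
Proof.
move=> c xi eta; apply: val_inj; apply/funext => j /=.
transitivity (c * trunc k xi j + trunc k eta j) => //; rewrite /trunc.
by case: ifP => // _; rewrite mulr0 addr0.
Qed.

Lemma wnorm_neg_l2_lty q (xi : l2_space R) : (wnorm (- q%:Z) xi < +oo)%E.
Proof.
have /asboolP := l2_valP xi; apply: le_lt_trans.
by apply: le_wnorm; rewrite lerNl oppr0.
Qed.

Lemma nrm_inv_cvg0 (M : R) : M / n.+1%:R @[n --> \oo] --> (0 : R).
Proof.
rewrite -[X in _ --> X](mulr0 M); apply: cvgM; first exact: cvg_cst.
exact: cvg_harmonic.
Qed.

(** One direction is homogeneity. For the other, [X] is evaluated on truncations, which lie in
    $l_2$, and the bound survives the coordinatewise limit. *)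
Lemma Lss_norm_leP X q (C : R) : 0 <= C ->
  (Lss_norm q X <= C%:E)%E <-> smooth_bound q C (restrict_l2 X).
Proof.
move=> C0; split=> [XC xi|XC].
  rewrite -[C]divr1.
  apply: (@homogeneous_bound (s'_space R) (fun xi => wnorm q%:Z (X xi))
    (fun xi => wnorm (- q%:Z) xi) 1 C _ _ _ _ _ _ _ (l2_to_s' xi)) => //.
  - by move=> v; exact: wnorm_ge0.
  - by move=> v; exact: wnorm_ge0.
  - by move=> c v; rewrite linearZ; exact: wnormZ.
  - by move=> c v; exact: wnormZ.
  - by move=> v /ltW v1; apply: le_trans XC; apply: ereal_sup_ubound; exists v.
  - exact: wnorm_neg_l2_lty.
apply: ge_ereal_sup => _ [xi xi1 <-].
(* Truncations need not approach [xi] at a known rate in $|\cdot|'_q$; in $|\cdot|'_{q+1}$ the error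
   is at most $1/(k+1)$. *)
have [M M0 XM] := Lss_bounded X q.+1.
have xioo : (wnorm (- q%:Z) xi < +oo)%E by apply: le_lt_trans xi1 (ltry _).
have qS : - q.+1%:Z = - q%:Z - 1%:Z by rewrite -addn1 PoszD opprD.
apply: (@wnorm_lim _ q%:Z (fun k => X (l2_to_s' (trunc_l2 k xi)))) => [k|].
  apply: le_trans (XC (trunc_l2 k xi)) _.
  rewrite -[leRHS]mule1 lee_wpmul2l// (le_trans (wnorm_trunc _ _ _))//.
apply: (@coord_cvg_wnorm _ q%:Z _ _ (fun k => M / k.+1%:R)).
- by move=> k; rewrite divr_ge0.
- move=> k; have -> : s_val (X xi) - s_val (X (l2_to_s' (trunc_l2 k xi))) =
      s_val (X (xi - l2_to_s' (trunc_l2 k xi))) by rewrite linearB.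
  apply: (@le_trans _ _ (wnorm q.+1%:Z (X (xi - l2_to_s' (trunc_l2 k xi))))).
    by apply: le_wnorm; rewrite lez_nat.
  have tail : (wnorm (- q.+1%:Z) (xi - l2_to_s' (trunc_l2 k xi))%R <=
      (k.+1%:R^-1)%:E)%E.
    rewrite qS; apply: le_trans (wnorm_sub_trunc (- q%:Z) 1 k xi) _.
    by rewrite -[leRHS]mule1 lee_wpmul2l// lee_fin invr_ge0.
  apply: le_trans (XM _ (le_lt_trans tail (ltry _))) _.
  by rewrite EFinM lee_wpmul2l.
- exact: nrm_inv_cvg0.
Qed.

End smooth_operators.

(** * Extension of bounded families from $l_2$ to $s'$ *)

Section extension.
Context {R : realType}.
Implicit Types (x : {linear l2_space R -> l2_space R}) (q : nat).

Definition smooth_extension (x : l2_space R -> l2_space R)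
    (xi : s'_space R) (i : nat) : R[i] :=
  limn (fun k => x (trunc_l2 k xi) i : R[i]^o).

(** The values on truncations are partial sums of the images of the single-coordinate increments
    [d j], and this series converges absolutely in each coordinate. *)
Lemma smooth_extension_cvg x : (forall q, exists2 C, 0 <= C & smooth_bound q C x) ->
  forall xi : s'_space R,
    coord_cvg (fun k => x (trunc_l2 k xi)) (smooth_extension x xi).
Proof.
move=> xC xi i; have /asboolP[p xip] := s'_valP xi.
(* The two orders beyond [p] produce the summable factor $(j+1)^{-2}$. *)
have [C C0 {}xC] := xC p.+2.
pose d k := trunc_l2 k.+1 xi - trunc_l2 k xi.
rewrite /smooth_extension.
have -> : (fun k => x (trunc_l2 k xi) i : R[i]^o) =
    (fun k => \sum_(0 <= j < k) x (d j) i).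
  apply/funext; elim=> [|k IHk].
    rewrite big_geq// (_ : trunc_l2 0 xi = 0) ?linear0//.
    exact: val_inj.
  rewrite big_nat_recr//= -IHk -[trunc_l2 k.+1 xi](subrK (trunc_l2 k xi)).
  by rewrite linearD addrC.
apply: (@is_cvg_sumc _ (fun j => x (d j) i) (C * nrm (- p%:Z) xi * 2)) => n.
apply: le_trans (_ : \sum_(0 <= j < n) C * nrm (- p%:Z) xi * j.+1%:R ^- 2 <= _).
  apply: ler_sum => j _.
  have dj : d j = trunc_l2 j.+1 xi - trunc_l2 j (l2_to_s' (trunc_l2 j.+1 xi)).
    congr (_ - _); apply: val_inj; apply/funext => l /=; rewrite /trunc.
    by case: ifP => // lj; rewrite (ltn_trans lj).
  have djle : (wnorm (- p.+2%:Z) (d j) <= (j.+1%:R ^- 2 * nrm (- p%:Z) xi)%:E)%E.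
    have -> : - p.+2%:Z = - p%:Z - 2%:Z by rewrite -[p.+2]addn2 PoszD opprD.
    rewrite dj; apply: le_trans (wnorm_sub_trunc (- p%:Z) 2 j (trunc j.+1 xi)) _.
    rewrite EFinM -nrmE// lee_wpmul2l//.
    exact: wnorm_trunc.
  have := normc_coord_le p.+2%:Z (x (d j)) i (C * (j.+1%:R ^- 2 * nrm (- p%:Z) xi)).
  move=> /(_ _ _)/le_trans; apply.
  - by rewrite !mulr_ge0 ?nrm_ge0// invr_ge0 exprn_ge0.
  - by apply: le_trans (xC (d j)) _; rewrite EFinM lee_wpmul2l.
  - rewrite [in leRHS]mulrAC -mulrA ler_piMr//.
      by rewrite !mulr_ge0 ?nrm_ge0// invr_ge0 exprn_ge0.
    by rewrite -invr_expz invf_le1 ?exprz_gt0// exprn_ege1// ler1n.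
by rewrite -mulr_sumr ler_wpM2l ?sum_inv_sqr_le// mulr_ge0 ?nrm_ge0.
Qed.

Lemma smooth_extension_le x q (C : R) :
  (forall q, exists2 C, 0 <= C & smooth_bound q C x) ->
  0 <= C -> smooth_bound q C x ->
  forall xi : s'_space R, (wnorm (- q%:Z) xi < +oo ->
    wnorm q%:Z (smooth_extension x xi) <= C%:E * wnorm (- q%:Z) xi)%E.
Proof.
move=> xb C0 xC xi xioo; rewrite [wnorm (- _) _]nrmE// -EFinM.
apply: wnorm_lim (smooth_extension_cvg x xb xi) => k.
apply: le_trans (xC _) _; rewrite EFinM -nrmE// lee_wpmul2l//.
exact: wnorm_trunc.
Qed.

Lemma smooth_extension_linear x :
  (forall q, exists2 C, 0 <= C & smooth_bound q C x) ->
  linear (smooth_extension x).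
Proof.
move=> xb c xi eta; apply: coord_cvg_unique (smooth_extension_cvg x xb _) _ => i.
have -> : (fun k => x (trunc_l2 k (c *: xi + eta)) i : R[i]^o) =
    (fun k => (c * x (trunc_l2 k xi) i + x (trunc_l2 k eta) i) : R[i]^o).
  by apply/funext => k; rewrite trunc_l2_linear linearP.
apply: cvgD; last exact: smooth_extension_cvg.
apply: (@cvgM _ _ _ _ (fun=> c)); first exact: cvg_cst.
exact: smooth_extension_cvg.
Qed.

(** The converse extends [x] along truncations. Preimages of seminorm balls are absolutely convex
    and contain a ball of every step, which is continuity for the inductive limit topology. *)
Lemma in_LssP x :
  in_Lss x <-> forall q, exists2 C, 0 <= C & smooth_bound q C x.
Proof.
split=> [[X xX] q|xb].
  have [M M0 XM] := Lss_bounded X q; exists M => // xi; rewrite xX.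
  by apply: (XM (l2_to_s' xi)); exact: wnorm_neg_l2_lty.
have ext_s (xi : s'_space R) : smooth_extension x xi \in in_s R.
  have /asboolP[p xip] := s'_valP xi; apply/asboolP => q.
  have [C C0 xC] := xb (maxn p q).
  apply: (@le_lt_trans _ _ (wnorm (maxn p q)%:Z (smooth_extension x xi))).
    by apply: le_wnorm; rewrite lez_nat leq_maxr.
  have xioo : (wnorm (- (maxn p q)%:Z) xi < +oo)%E.
    by apply: le_lt_trans xip; apply: le_wnorm; rewrite lerN2 lez_nat leq_maxl.
  apply: le_lt_trans (smooth_extension_le x _ C xb C0 xC xi xioo) _.
  by rewrite nrmE// -EFinM ltry.
pose f xi : s_space R := SSpace (ext_s xi).
have f_linear : linear f.
  by move=> c xi eta; apply: val_inj; exact: smooth_extension_linear.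
pose F : {linear s'_space R -> s_space R} :=
  HB.pack f (GRing.isLinear.Build R[i] (s'_space R) (s_space R) _ f f_linear).
have f_continuous : continuous F.
  apply/continuousP => A Ao.
  suff : open_of_base0 (@s'_base0 R) (F @^-1` A) by [].
  move=> xi /= Axi; have [U [q [e e0 eU]] UA] := Ao _ Axi.
  exists [set eta : s'_space R | (wnorm q%:Z (f eta) < e%:E)%E].
    split=> [a b eta zeta ab | p].
      rewrite /mkset => etae zetae.
      have fab_le : (wnorm q%:Z (f (a *: eta + b *: zeta)%R) <=
          (normc a)%:E * wnorm q%:Z (f eta) + (normc b)%:E * wnorm q%:Z (f zeta))%E.
        have -> : f (a *: eta + b *: zeta) = a *: f eta + b *: f zeta.
          by rewrite f_linear; congr (_ + _); exact: (linearZZ F b zeta).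
        by rewrite -!wnormZ; exact: wnormD.
      apply: le_lt_trans fab_le _.
      have etaE := nrmE _ _ (lt_trans etae (ltry e)).
      have zetaE := nrmE _ _ (lt_trans zetae (ltry e)).
      move: etae zetae; rewrite etaE zetaE -!EFinM -EFinD !lte_fin => etae zetae.
      move: ab; rewrite !normrcE -rmorphD lecR => ab.
      set r := nrm q%:Z (f eta) in etae *; set s := nrm q%:Z (f zeta) in zetae *.
      apply: (@le_lt_trans _ _ ((normc a + normc b) * Num.max r s)).
        by rewrite mulrDl lerD// ler_wpM2l ?normc_ge0// le_max lexx ?orbT.
      apply: (@le_lt_trans _ _ (Num.max r s)); last by rewrite gt_max etae.
      by rewrite ler_piMl// le_max nrm_ge0.
    (* At level $\max(p,q)$ the output norm dominates $|\cdot|_q$ and the input norm is dominated by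
       $|\cdot|'_p$. *)
    have [C C0 xC] := xb (maxn p q).
    exists (e / (C + 1)) => [|eta etae]; first by rewrite divr_gt0// ltr_wpDl.
    apply: (@le_lt_trans _ _ (wnorm (maxn p q)%:Z (f eta))).
      by apply: le_wnorm; rewrite lez_nat leq_maxr.
    have eta_le : (wnorm (- (maxn p q)%:Z) eta <= (e / (C + 1))%:E)%E.
      by apply: le_trans (ltW etae); apply: le_wnorm; rewrite lerN2 lez_nat leq_maxl.
    have := smooth_extension_le x _ C xb C0 xC eta (le_lt_trans eta_le (ltry _)).
    move=> /le_lt_trans; apply.
    apply: (@le_lt_trans _ _ (C%:E * (e / (C + 1))%:E)%E); first by rewrite lee_wpmul2l.
    by rewrite -EFinM lte_fin mulrCA gtr_pMr// ltr_pdivrMr ?ltr_wpDl// mul1r ltrDl.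
  by move=> eta /eU /UA; rewrite -(linearD F xi eta : f (xi + eta) = f xi + f eta).
exists (MkLss f_continuous) => xi; apply: val_inj.
apply: coord_cvg_unique (smooth_extension_cvg x xb (l2_to_s' xi)).
(* It remains to see that the extension agrees with [x] on $l_2$: truncations of an element of $l_2$
   converge in $|\cdot|'_1$ at rate $1/(k+1)$. *)
have [C C0 xC] := xb 1%N.
have xioo : (wnorm 0 xi < +oo)%E by have /asboolP := l2_valP xi.
apply: (@coord_cvg_wnorm _ 1 _ _ (fun k => C * nrm 0 xi / k.+1%:R)).
- by move=> k; rewrite divr_ge0// mulr_ge0 ?nrm_ge0.
- move=> k; set t := trunc_l2 k (l2_to_s' xi).
  have -> : l2_val (x xi) - l2_val (x t) = l2_val (x (xi - t)) by rewrite linearB.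
  apply: le_trans (xC _) _.
  rewrite -mulrA EFinM lee_wpmul2l//.
  apply: le_trans (wnorm_sub_trunc 0 1 k xi) _.
  by rewrite nrmE// -EFinM lee_fin mulrC.
- exact: nrm_inv_cvg0.
Qed.

(** The norm is the least smooth bound. Smooth bounds involve [x] alone, so the extension picked by
    [xget] does not matter. *)
Lemma Lss_norm_l2P x : in_Lss x -> forall q, exists2 r : R, 0 <= r &
  [/\ Lss_norm_l2 q x = r%:E, smooth_bound q r x &
      forall C, 0 <= C -> smooth_bound q C x -> r <= C].
Proof.
move=> x_in q.
have [X xX normE] : exists2 X, x =1 restrict_l2 X & Lss_norm_l2 q x = Lss_norm q X.
  have [X xX] := x_in; apply: (@xgetPex _ 0%E [set r | exists2 X : Lss,
    x =1 restrict_l2 X & r = Lss_norm q X]).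
  by exists (Lss_norm q X), X.
have boundE C : smooth_bound q C x <-> smooth_bound q C (restrict_l2 X).
  by split=> b xi; [rewrite -xX|rewrite xX]; exact: b.
have norm_ge0 : (0 <= Lss_norm q X)%E.
  apply: (@le_trans _ _ (wnorm q%:Z (X 0))); first exact: wnorm_ge0.
  by apply: ereal_sup_ubound; exists 0 => //=; rewrite wnorm0.
have [M M0 /boundE /Lss_norm_leP normM] := (in_LssP x).1 x_in q.
have normfin : Lss_norm q X \is a fin_num.
  by rewrite ge0_fin_numE// (le_lt_trans (normM M0) (ltry _)).
have fine0 : 0 <= fine (Lss_norm q X) by exact: fine_ge0.
exists (fine (Lss_norm q X)) => //; split; first by rewrite fineK.
  by apply/boundE/Lss_norm_leP => //; rewrite fineK.
by move=> C C0 /boundE xC; rewrite -lee_fin fineK//; apply/Lss_norm_leP.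
Qed.

End extension.

(** * The inner product, and norm estimates for orthogonal projections *)

Section projections.
Context {R : realType}.
Implicit Types (x P : {linear l2_space R -> l2_space R}) (q : nat) (z : int).
Implicit Types (xi eta zeta : l2_space R).

Lemma wnorm_l2_lty xi : (wnorm 0 xi < +oo)%E.
Proof. by have /asboolP := l2_valP xi. Qed.

Lemma smooth_boundP q (C : R) (x : l2_space R -> l2_space R) :
  smooth_bound q C x <-> forall xi,
    (wnorm q%:Z (x xi) < +oo)%E /\ nrm q%:Z (x xi) <= C * nrm (- q%:Z) xi.
Proof.
split=> xC xi.
  have := xC xi; rewrite (nrmE _ _ (wnorm_neg_l2_lty q xi)) -EFinM => xCxi.
  have xioo := le_lt_trans xCxi (ltry _).
  by split=> //; rewrite -lee_fin -nrmE.
by have [xioo] := xC xi; rewrite (nrmE _ _ xioo) (nrmE _ _ (wnorm_neg_l2_lty q xi)).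
Qed.

Let inner_term_le z xi eta k :
  (wnorm z xi < +oo)%E -> (wnorm (- z) eta < +oo)%E ->
  \sum_(0 <= j < k) normc (xi j * (eta j)^*%R) <= nrm z xi * nrm (- z) eta.
Proof.
move=> xioo etaoo; apply: le_trans (wsum_cauchy_schwarz z (- z) xi eta k xioo etaoo).
by apply: ler_sum => j _; rewrite subrr expr0z mulr1 normcM normc_conj.
Qed.

Lemma inner_cvg xi eta :
  (\sum_(0 <= j < n) xi j * (eta j)^*%R : R[i]^o) @[n --> \oo] -->
  (inner xi eta : R[i]^o).
Proof.
apply: (@is_cvg_sumc _ (fun j => xi j * (eta j)^*%R) (nrm 0 xi * nrm (- 0) eta)) => n.
by apply: inner_term_le; rewrite ?oppr0 wnorm_l2_lty.
Qed.

Lemma innerE xi eta (c : R[i]) :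
  (\sum_(0 <= j < n) xi j * (eta j)^*%R : R[i]^o) @[n --> \oo] --> (c : R[i]^o) ->
  inner xi eta = c.
Proof. by move=> h; exact: (cvg_unique _ (inner_cvg xi eta) h). Qed.

Lemma normc_inner_le z xi eta :
  (wnorm z xi < +oo)%E -> (wnorm (- z) eta < +oo)%E ->
  normc (inner xi eta) <= nrm z xi * nrm (- z) eta.
Proof.
move=> xioo etaoo; have /cvg_normc := inner_cvg xi eta => h.
rewrite -(cvg_lim _ h)//; apply: limr_le; first by apply/cvg_ex; eexists; exact: h.
apply: nearW => n; apply: le_trans (normc_sum _ _) _.
exact: inner_term_le.
Qed.

Lemma innerDl xi eta zeta : inner (xi + eta) zeta = inner xi zeta + inner eta zeta.
Proof.
have h := @cvgD _ R[i]^o _ _ eventually_filter _ _ _ _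
  (inner_cvg xi zeta) (inner_cvg eta zeta).
apply: innerE; move: h; apply: cvg_trans; apply: near_eq_cvg.
apply: nearW => n; rewrite /= -[LHS]big_split/=.
by apply: eq_bigr => j _; rewrite -mulrDl.
Qed.

Lemma innerC xi eta : inner eta xi = (inner xi eta)^*%R.
Proof.
have h := cvg_conjc _ _ (inner_cvg xi eta).
apply: innerE; move: h; apply: cvg_trans; apply: near_eq_cvg.
apply: nearW => n; apply/esym.
by rewrite rmorph_sum; apply: eq_bigr => j _; rewrite rmorphM /= conjCK mulrC.
Qed.

Lemma inner0r xi : inner xi 0 = 0.
Proof.
apply: eq0_normc; apply/eqP; rewrite eq_le normc_ge0 andbT.
have := @normc_inner_le 0 xi 0; rewrite oppr0 !wnorm_l2_lty => /(_ isT isT).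
by rewrite [nrm 0 0](_ : _ = 0) ?mulr0// /nrm wnorm0.
Qed.

(** Here [zeta] is $D^{2z}\xi$ for the diagonal operator $D$ with entries $j+1$, so the pairing is
    the weighted sum of squares. *)
Lemma inner_weighted z xi zeta : (wnorm z xi < +oo)%E ->
  (forall j, zeta j = (weight z j)%:C * xi j) ->
  inner xi zeta = (nrm z xi ^+ 2)%:C.
Proof.
move=> xioo zetaE; have h := cvg_realc _ _ (wsum_cvg z xi xioo).
apply: innerE; move: h; apply: cvg_trans; apply: near_eq_cvg.
apply: nearW => n; apply/esym.
rewrite rmorph_sum; apply: eq_bigr => j _.
have conjM (a b : R[i]) : (a * b)^*%R = a^*%R * b^*%R by exact: rmorphM.
have w_real : (weight z j)%:C^*%R = (weight z j)%:C :> R[i].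
  by apply/eqP; rewrite eq_complex /= oppr0 !eqxx.
have termE : xi j * (zeta j)^*%R = (normc (xi j) ^+ 2 * weight z j)%:C.
  by rewrite zetaE conjM w_real mulrCA mulc_conj mulrC -rmorphM.
by rewrite termE.
Qed.

Lemma inner_self xi : inner xi xi = (nrm 0 xi ^+ 2)%:C.
Proof.
apply: inner_weighted; first exact: wnorm_l2_lty.
by move=> j; rewrite weight0 mul1r.
Qed.

Lemma nrm_proj_sqr P xi : projection P ->
  inner (P xi) xi = (nrm 0 (P xi) ^+ 2)%:C.
Proof.
move=> [_ PP Padj]; have PPE : P (P xi) = P xi := PP xi.
by rewrite -inner_self [RHS]Padj PPE -Padj.
Qed.

Lemma nrm_proj_sqr_le z P xi : projection P ->
  (wnorm z (P xi) < +oo)%E -> (wnorm (- z) xi < +oo)%E ->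
  nrm 0 (P xi) ^+ 2 <= nrm z (P xi) * nrm (- z) xi.
Proof.
move=> projP Pxioo xioo; apply: le_trans (normc_inner_le _ _ _ Pxioo xioo).
by rewrite nrm_proj_sqr// normc_real ger0_norm ?sqr_ge0.
Qed.

(** Division by [a], with $a = 0$ apart; it makes a self-referential quadratic estimate linear. *)
Lemma ler_of_sqr_le (a c b : R) : 0 <= a -> 0 <= c -> 0 <= b ->
  a ^+ 2 <= c * (a * b) -> a <= c * b.
Proof.
move=> a0 c0 b0; have [->|an0] := eqVneq a 0; first by rewrite mulr_ge0.
by rewrite expr2 mulrCA ler_pM2l// lt_neqAle eq_sym an0.
Qed.

(** One has $|P\xi|_q^2 \le C^2 |P\xi|_0^2 \le C^2 |P\xi|_q |\xi|'_q$, and a factor $|P\xi|_q$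
    cancels. *)
Lemma smooth_bound_of_range P q (C : R) : projection P -> 0 <= C ->
  (forall xi, (wnorm q%:Z (P xi) < +oo)%E /\
              nrm q%:Z (P xi) <= C * nrm 0 (P xi)) ->
  smooth_bound q (C ^+ 2) P.
Proof.
move=> projP C0 PC; apply/smooth_boundP => xi; have [Pxioo PCxi] := PC xi.
split=> //; apply: ler_of_sqr_le; rewrite ?nrm_ge0 ?sqr_ge0//.
apply: (@le_trans _ _ (C ^+ 2 * nrm 0 (P xi) ^+ 2)).
  by rewrite -exprMn lerXn2r ?nnegrE ?mulr_ge0 ?nrm_ge0.
by rewrite ler_wpM2l ?sqr_ge0// nrm_proj_sqr_le// wnorm_neg_l2_lty.
Qed.

(* Duality: with [zeta = D^(2q) eta], [D] the diagonal operator [(j)_j], one has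
   [|eta|_q^2 = <P eta, zeta> = <eta, P zeta>] and [|zeta|'_q = |eta|_q]. *)
Lemma range_bound_of_smooth P q (C : R) : projection P -> in_Lss P -> 0 <= C ->
  smooth_bound q (C ^+ 2) P -> forall xi, nrm q%:Z (P xi) <= C * nrm 0 (P xi).
Proof.
move=> projP P_in C0 /smooth_boundP PC xi; have [_ PP Padj] := projP.
have PPE v : P (P v) = P v := PP v.
have eta_fin k : (wnorm k%:Z (P xi) < +oo)%E.
  have [D _ /smooth_boundP PD] := (in_LssP P).1 P_in k.
  by have [] := PD xi.
set eta := P xi in eta_fin *.
(* [zeta] is in $l_2$ because its norm is at most $|\eta|_{2q}$, finite as [P] maps into $s$. *)
have zeta_le : (wnorm 0 (fun j => (weight q%:Z j)%:C * eta j)%R <=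
    1%:E * wnorm (2 * q)%N%:Z eta)%E.
  apply: wnorm_le_scale => // j; rewrite normcM normc_real gtr0_norm ?weight_gt0//.
  rewrite weight0 mulr1 exprMn mulrC expr1n mul1r [weight _ _ ^+ 2]expr2.
  by rewrite -weightD -PoszD addnn -mul2n.
have zeta_l2 : (fun j => (weight q%:Z j)%:C * eta j) \in in_l2 R.
  by apply/asboolP; apply: le_lt_trans zeta_le _; rewrite mul1e eta_fin.
pose zeta := L2Space zeta_l2.
have nrm_zeta : nrm (- q%:Z) zeta <= nrm q%:Z eta.
  rewrite -lee_fin -(nrmE _ _ (wnorm_neg_l2_lty q zeta)) -(nrmE _ _ (eta_fin q)).
  rewrite -[leRHS]mul1e.
  apply: wnorm_le_scale => // j.
  rewrite [zeta j]/((weight q%:Z j)%:C * eta j) normcM normc_real.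
  rewrite gtr0_norm ?weight_gt0// exprMn expr1n mul1r mulrAC mulrC ler_wpM2l ?sqr_ge0//.
  by rewrite expr2 -mulrA -weightD subrr weight0 mulr1.
have eta_sqr : nrm q%:Z eta ^+ 2 <= nrm 0 eta * nrm 0 (P zeta).
  have := normc_inner_le 0 eta (P zeta); rewrite oppr0 !wnorm_l2_lty => /(_ isT isT).
  apply: le_trans; rewrite -Padj PPE (inner_weighted q%:Z)//.
  by rewrite normc_real ger0_norm ?sqr_ge0.
have Pzeta : nrm 0 (P zeta) <= C * nrm q%:Z eta.
  rewrite -ler_sqr ?nnegrE ?mulr_ge0 ?nrm_ge0//.
  have [Pzetaoo PCzeta] := PC zeta.
  apply: le_trans (nrm_proj_sqr_le q%:Z P zeta projP Pzetaoo _) _.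
    exact: wnorm_neg_l2_lty.
  apply: (@le_trans _ _ (C ^+ 2 * nrm (- q%:Z) zeta * nrm (- q%:Z) zeta)).
    by rewrite ler_wpM2r ?nrm_ge0.
  rewrite -mulrA -expr2 -exprMn lerXn2r ?nnegrE ?mulr_ge0 ?nrm_ge0//.
  by rewrite ler_wpM2l.
apply: ler_of_sqr_le; rewrite ?nrm_ge0//.
apply: le_trans eta_sqr _; rewrite [leRHS]mulrA [leRHS]mulrC.
by rewrite ler_wpM2l ?nrm_ge0.
Qed.

(* In the notation of the paper, [||P||_q^2 <= ||P||_{2q}]. *)
Lemma smooth_bound_interpolation P q (C : R) : projection P -> in_Lss P ->
  0 <= C -> smooth_bound (2 * q) (C ^+ 2) P -> smooth_bound q C P.
Proof.
move=> projP P_in C0 PC; apply/smooth_boundP => xi.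
have eta_fin k : (wnorm k%:Z (P xi) < +oo)%E.
  have [D _ /smooth_boundP PD] := (in_LssP P).1 P_in k.
  by have [] := PD xi.
split=> //; set eta := P xi in eta_fin *.
have convex : nrm q%:Z eta ^+ 2 <= nrm 0 eta * nrm (2 * q)%N%:Z eta.
  have := wsum_cvg q%:Z eta (eta_fin q) => h.
  rewrite -(cvg_lim _ h)//; apply: limr_le; first by apply/cvg_ex; eexists; exact: h.
  apply: nearW => k.
  apply: le_trans (wsum_cauchy_schwarz 0 (2 * q)%N%:Z eta eta k _ (eta_fin _)).
    by apply: ler_sum => j _; rewrite add0r /weight -expr2 PoszM.
  exact: wnorm_l2_lty.
apply: ler_of_sqr_le; rewrite ?nrm_ge0//.
apply: le_trans convex _.
apply: (@le_trans _ _ (nrm 0 eta * (C * nrm 0 eta))).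
  by rewrite ler_wpM2l ?nrm_ge0// range_bound_of_smooth.
rewrite mulrCA ler_wpM2l// -expr2.
by rewrite nrm_proj_sqr_le// wnorm_neg_l2_lty.
Qed.

Lemma fine_Lss_norm_l2_ge0 P q : in_Lss P -> 0 <= fine (Lss_norm_l2 q P).
Proof. by move=> P_in; have [r r0 [-> _ _]] := Lss_norm_l2P P P_in q. Qed.

Lemma Lss_norm_l2_interpolation P q : projection P -> in_Lss P ->
  fine (Lss_norm_l2 q P) ^+ 2 <= fine (Lss_norm_l2 (2 * q) P).
Proof.
move=> projP P_in.
have [r r0 [-> _ rmin]] := Lss_norm_l2P P P_in q.
have [s s0 [-> sb _]] := Lss_norm_l2P P P_in (2 * q)%N.
rewrite /= -[s]sqr_sqrtr// lerXn2r ?nnegrE ?sqrtr_ge0//; apply: rmin => //.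
by apply: smooth_bound_interpolation => //; rewrite sqr_sqrtr.
Qed.

Lemma Lss_norm_l2_interpolation_iter P q k : projection P -> in_Lss P ->
  fine (Lss_norm_l2 q P) ^+ (2 ^ k) <= fine (Lss_norm_l2 (2 ^ k * q) P).
Proof.
move=> projP P_in; elim: k => [|k IHk]; first by rewrite mul1n.
apply: le_trans (_ : fine (Lss_norm_l2 (2 ^ k * q) P) ^+ 2 <= _).
  by rewrite expnS mulnC exprM lerXn2r ?nnegrE ?exprn_ge0 ?fine_Lss_norm_l2_ge0.
by rewrite expnS -mulnA Lss_norm_l2_interpolation.
Qed.

End projections.

(** * Rapidly decreasing real sequences *)

Section rapid_decay.
Context {R : realType}.
Implicit Types (v w : nat -> R).

(** Description of $s$ by weighted suprema, meant for nonnegative sequences and hence without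
    absolute values. *)
Definition rapid v : Prop :=
  forall p : nat, exists C, forall n, v n * n.+1%:R ^+ p <= C.

Lemma in_s_rapidP (f : nat -> R[i]) : f \in in_s R <-> rapid (fun n => normc (f n)).
Proof.
split=> [/asboolP fs p|fr].
  exists (nrm p%:Z f) => n; rewrite -ler_pdivlMr ?exprn_gt0//.
  apply: le_trans (normc_coord_le p%:Z f n (nrm p%:Z f) (nrm_ge0 _ _) _) _.
    by rewrite nrmE.
  by rewrite -invr_expz.
(* The extra power, once squared, leaves the summable factor $(j+1)^{-2}$. *)
apply/asboolP => q; have [C fC] := fr q.+1.
have C0 : 0 <= C by apply: le_trans (fC 0%N); rewrite mulr_ge0 ?normc_ge0.
apply: le_lt_trans (_ : _ <= (2 * C)%:E)%E (ltry _).
apply/wnorm_leP => [|k]; first by rewrite mulr_ge0.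
apply: (@le_trans _ _ (\sum_(0 <= j < k) C ^+ 2 * j.+1%:R ^- 2)).
  apply: ler_sum => j _; rewrite ler_pdivlMr ?exprn_gt0//.
  have -> : weight q%:Z j = (j.+1%:R ^+ q) ^+ 2 :> R.
    by rewrite -exprM mulnC /weight -PoszM.
  by rewrite -mulrA -!exprMn -exprSr lerXn2r ?nnegrE ?mulr_ge0 ?normc_ge0 ?exprn_ge0.
rewrite -mulr_sumr; apply: le_trans (ler_wpM2l (sqr_ge0 C) (sum_inv_sqr_le k)) _.
by have := sqr_ge0 C; rewrite exprMn; lra.
Qed.

Lemma rapid_le (c : R) v w : 0 <= c -> (forall n, v n <= c * w n) ->
  rapid w -> rapid v.
Proof.
move=> c0 vw wr p; have [C wC] := wr p; exists (c * C) => n.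
apply: le_trans (ler_wpM2r _ (vw n)) _; first exact: exprn_ge0.
by rewrite -mulrA ler_wpM2l.
Qed.

(** Decay of order $pm$ for the powers is decay of order $p$ for [v], since $a \le \max(1, a^m)$. *)
Lemma rapid_root (m : nat) v : (0 < m)%N -> (forall n, 0 <= v n) ->
  rapid (fun n => v n ^+ m) -> rapid v.
Proof.
move=> m0 v0 vr p; have [C vC] := vr (p * m)%N; exists (Num.max 1 C) => n.
set a := v n * _; have a0 : 0 <= a by rewrite mulr_ge0 ?exprn_ge0.
have amC : a ^+ m <= C by rewrite exprMn -exprM.
rewrite le_max; have [//|/ltW a1] := leP a 1.
by apply/orP; right; apply: le_trans amC; rewrite ler_eXnr.
Qed.

Lemma rapid_summable v : (forall n, 0 <= v n) -> rapid v ->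
  (\sum_(0 <= n <oo) (v n)%:E < +oo)%E.
Proof.
move=> v0 vr; have [C vC] := vr 2%N.
have C0 : 0 <= C by apply: le_trans (vC 0%N); rewrite mulr_ge0.
apply: le_lt_trans (_ : _ <= (C * 2)%:E)%E (ltry _).
apply: lime_le; first by apply: is_cvg_nneseries => n _ _; rewrite lee_fin.
apply: nearW => k; rewrite sumEFin lee_fin.
apply: (@le_trans _ _ (\sum_(0 <= j < k) C * j.+1%:R ^- 2)).
  by apply: ler_sum => j _; rewrite ler_pdivlMr ?exprn_gt0.
by rewrite -mulr_sumr ler_wpM2l// sum_inv_sqr_le.
Qed.

End rapid_decay.

(** * Spectral representations and decay of the eigenvalues *)

Section spectral.
Context {R : realType}.
Implicit Types (x : {linear l2_space R -> l2_space R}) (q : nat).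
Implicit Types (P : nat -> {linear l2_space R -> l2_space R}) (lam : nat -> R[i]).
Implicit Types (xi eta : l2_space R).

Lemma nrmZ z (c : R[i]) (xi : nat -> R[i]) : (wnorm z xi < +oo)%E ->
  nrm z (c *: xi) = normc c * nrm z xi.
Proof. by move=> xioo; rewrite /nrm wnormZ fineM// ge0_fin_numE// wnorm_ge0. Qed.

Lemma nrm0_eq0 xi : nrm 0 xi = 0 -> xi = 0.
Proof. by move=> xi0; apply: l2_norm_eq0; rewrite /l2_norm -/(nrm 0 xi) xi0. Qed.

(** On the range of [p] the operator [x] is multiplication by [c], so $|p\xi|_q \le
    (C/|c|)\,|p\xi|'_q \le (C/|c|)\,|p\xi|_0$; the range estimate then squares the constant. *)
Lemma smooth_bound_eigenprojection x (p : {linear l2_space R -> l2_space R})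
    (c : R[i]) q (C : R) : projection p -> c != 0 ->
  (forall xi, x (p xi) = c *: p xi) -> 0 <= C -> smooth_bound q C x ->
  smooth_bound q ((C / normc c) ^+ 2) p.
Proof.
move=> proj_p c0 xp C0 /smooth_boundP xC.
have nc0 : 0 < normc c.
  by rewrite lt_neqAle normc_ge0 andbT eq_sym; apply: contraNneq c0 => /eq0_normc ->.
apply: smooth_bound_of_range => // [|xi]; first by rewrite divr_ge0 ?normc_ge0.
have [xpoo xpC] := xC (p xi).
have poo : (wnorm q%:Z (p xi) < +oo)%E.
  have -> : p xi = c^-1 *: x (p xi) by rewrite xp scalerA mulVf// scale1r.
  rewrite [wnorm _ _](wnormZ _ _ (x (p xi))) (nrmE _ _ xpoo) -EFinM.
  exact: ltry.
split=> //; rewrite mulrAC ler_pdivlMr// mulrC -nrmZ//.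
have -> : c *: l2_val (p xi) = l2_val (x (p xi)) by rewrite xp.
apply: le_trans xpC _; rewrite ler_wpM2l//.
rewrite -lee_fin -(nrmE _ _ (wnorm_l2_lty _)) -(nrmE _ _ (wnorm_neg_l2_lty q _)).
by apply: le_wnorm; rewrite lerNl oppr0.
Qed.

Lemma wnorm_sum_le P lam q (c : nat -> R) (N : nat) xi :
  (forall n, (n < N)%N -> 0 <= c n /\ smooth_bound q (c n) (P n)) ->
  (wnorm q%:Z (\sum_(0 <= n < N) lam n *: P n xi : l2_space R)%R <=
   (\sum_(0 <= n < N) normc (lam n) * c n)%R%:E * wnorm (- q%:Z) xi)%E.
Proof.
elim: N => [|N IHN] Pc; first by rewrite !big_geq// mul0e wnorm0.
rewrite !big_nat_recr//=; apply: le_trans (wnormD _ _ _) _.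
have c0 : 0 <= \sum_(0 <= n < N) normc (lam n) * c n.
  rewrite big_nat; apply: sumr_ge0 => n /andP[_ nN].
  by have [c0 _] := Pc n (ltnW nN); rewrite mulr_ge0 ?normc_ge0.
have [cN PN] := Pc N (ltnSn N).
rewrite EFinD ge0_muleDl ?lee_fin ?mulr_ge0 ?normc_ge0//.
apply: leeD; first by apply: IHN => n nN; apply: Pc; rewrite ltnW.
rewrite [wnorm _ _](wnormZ _ _ (P N xi)) EFinM -muleA lee_wpmul2l//.
by rewrite lee_fin normc_ge0.
Qed.

Lemma spectral_sum_range D lam P (N n : nat) xi : spectral_family D lam P ->
  (forall k, (k < N)%N -> D k) -> (n < N)%N ->
  \sum_(0 <= k < N) lam k *: P k (P n xi) = lam n *: P n xi.
Proof.
move=> [_ _ _ DP Dorth] ND nN.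
rewrite (bigD1_seq n) ?mem_index_iota ?iota_uniq//=.
have [[_ PP _] _ _] := DP n (ND n nN).
have -> : P n (P n xi) = P n xi := PP xi.
rewrite big_nat_cond big1 ?addr0// => k /andP[/andP[_ kN] kn].
by rewrite Dorth ?scaler0//; [exact: ND|exact: ND|exact/eqP].
Qed.

Lemma infinite_spectral_cvg x lam P : infinite_spectral_rep x lam P ->
  forall xi, coord_cvg (fun N => \sum_(0 <= n < N) lam n *: P n xi : l2_space R) (x xi).
Proof.
move=> [_ _ cvg0] xi.
pose T N eta := x eta - \sum_(0 <= n < N) lam n *: P n eta.
have TZ N c eta : T N (c *: eta) = c *: T N eta.
  rewrite /T linearZ scalerBr scaler_sumr; congr (_ - _).
  by apply: eq_bigr => n _; rewrite linearZ scalerA mulrC -scalerA.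
(* Scaling by [c] brings [xi] into the unit ball; the summand 1 covers [xi = 0]. *)
pose c := (nrm 0 xi + 1)^-1.
have c0 : 0 < c by rewrite invr_gt0 ltr_wpDl ?nrm_ge0.
have cT N : ((c * nrm 0 (T N xi))%:E <= op_norm (T N))%E.
  rewrite EFinM -(nrmE _ _ (wnorm_l2_lty _)) -[c in c%:E](gtr0_norm c0) -normc_real.
  rewrite -[leLHS](wnormZ 0 c%:C (T N xi)).
  rewrite [c%:C *: _](_ : _ = l2_val (T N (c%:C *: xi))); last by rewrite TZ.
  apply: ereal_sup_ubound; exists (c%:C *: xi) => //=.
  rewrite [wnorm _ _](wnormZ 0 c%:C xi) normc_real gtr0_norm//.
  rewrite (nrmE _ _ (wnorm_l2_lty _)) -EFinM lee_fin mulrC.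
  by rewrite ler_pdivrMr ?ltr_wpDl ?nrm_ge0// mul1r lerDl.
have cT0 : (c * nrm 0 (T N xi))%:E @[N --> \oo] --> 0%E.
  apply: (@squeeze_cvge _ _ _ _ (fun=> 0%E) _ (fun N => op_norm (T N))) => //.
    apply: nearW => N; rewrite cT andbT lee_fin.
    by rewrite mulr_ge0 ?nrm_ge0// ltW.
  exact: cvg_cst.
apply: (@coord_cvg_wnorm _ 0 _ _ (fun N => nrm 0 (T N xi))).
- by move=> N; exact: nrm_ge0.
- by move=> N; rewrite -(nrmE _ _ (wnorm_l2_lty _)).
- have /fine_cvg/(cvgM (cvg_cst c^-1)) := cT0; rewrite mulr0.
  apply: cvg_trans; apply: near_eq_cvg; apply: nearW => N /=.
  by rewrite mulKf ?gt_eqF.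
Qed.

(** By orthogonality the partial sums at [P n xi] are constant from $N = n+1$ on. *)
Lemma infinite_spectral_range x lam P : infinite_spectral_rep x lam P ->
  forall n xi, x (P n xi) = lam n *: P n xi.
Proof.
move=> rep n xi; have [fam _ _] := rep.
apply: val_inj; apply: coord_cvg_unique (infinite_spectral_cvg x lam P rep (P n xi)) _.
move=> j; apply: cvg_near_cst; exists n.+1 => // N nN.
have e : \sum_(0 <= k < N) lam k *: P k (P n xi) = lam n *: P n xi.
  exact: spectral_sum_range fam _ nN.
exact: (congr1 (fun eta : l2_space R => l2_val eta j) e).
Qed.

Lemma nrm_sqrD xi eta : inner xi eta = 0 ->
  nrm 0 (xi + eta : l2_space R) ^+ 2 = nrm 0 xi ^+ 2 + nrm 0 eta ^+ 2.
Proof.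
move=> orth; have orth' : inner eta xi = 0 by rewrite innerC orth rmorph0.
have innerDr zeta : inner zeta (xi + eta) = inner zeta xi + inner zeta eta.
  by rewrite innerC innerDl rmorphD /= -!innerC.
suff [] : (nrm 0 (xi + eta : l2_space R) ^+ 2)%:C =
  (nrm 0 xi ^+ 2 + nrm 0 eta ^+ 2)%:C :> R[i] by [].
rewrite rmorphD /= -(inner_self xi) -(inner_self eta) -(inner_self (xi + eta)).
rewrite innerDl !innerDr orth orth' addr0.
by rewrite add0r.
Qed.

Lemma nrm_sqr_sum (w : nat -> l2_space R) (k : nat) :
  (forall i j, i <> j -> inner (w i) (w j) = 0) ->
  nrm 0 (\sum_(0 <= i < k) w i : l2_space R) ^+ 2 = \sum_(0 <= i < k) nrm 0 (w i) ^+ 2.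
Proof.
move=> orth; elim: k => [|k IHk].
  by rewrite !big_geq// /nrm wnorm0 expr0n.
rewrite !big_nat_recr//= nrm_sqrD ?IHk//.
have : forall m, (m <= k)%N -> inner (\sum_(0 <= i < m) w i) (w k) = 0.
  elim=> [|m IHm] mk; first by rewrite big_geq// innerC inner0r rmorph0.
  rewrite big_nat_recr//= innerDl IHm ?(ltnW mk)// add0r orth//.
  by move=> mk'; rewrite mk' ltnn in mk.
exact.
Qed.

(** A matrix with $n+1$ rows and $n$ columns has a nonzero left kernel. *)
Lemma exists_nontrivial_relation (F : fieldType) (a : nat -> nat -> F) (n : nat) :
  exists v : nat -> F, (exists2 m, (m <= n)%N & v m != 0) /\
    forall j, (j < n)%N -> \sum_(0 <= m < n.+1) v m * a m j = 0.
Proof.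
pose A := \matrix_(m < n.+1, j < n) a m j.
have /rowV0Pn[v /sub_kermxP vA v0] : kermx A != 0.
  rewrite kermx_eq0; apply/negP => /eqP rkA.
  by have := rank_leq_col A; rewrite rkA ltnn.
exists (fun m => v 0 (inord m)); split.
  have /rV0Pn[i vi] := v0; exists i; first by rewrite -ltnS.
  by rewrite inord_val.
move=> j jn; have /matrixP/(_ 0 (Ordinal jn)) := vA; rewrite !mxE => {2}<-.
rewrite big_mkord; apply: eq_bigr => i _.
by rewrite mxE inord_val.
Qed.

(* A nonzero combination [eta] of eigenvectors to the [n+1] largest eigenvalues
   can be chosen with its first [n] coordinates equal to 0; then
   [|lam n| |eta| <= |x eta|_q <= C |eta|'_q <= C (n+1)^-q |eta|]. *)
Lemma eigenvalue_decay x lam P q (C : R) : infinite_spectral_rep x lam P ->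
  0 <= C -> smooth_bound q C x -> forall n, normc (lam n) * n.+1%:R ^+ q <= C.
Proof.
move=> rep C0 /smooth_boundP xC n.
have xP := infinite_spectral_range x lam P rep.
have [[_ _ lam_dec famP orthP] _ _] := rep.
have {}famP m : projection (P m) /\ exists xi, P m xi != 0.
  by have [? _ ?] := famP m I.
pose u m := P m (xchoose (famP m).2).
have u0 m : u m != 0 by exact: (xchooseP (famP m).2).
have [v [[m mn vm0] v_rel]] := exists_nontrivial_relation _ (fun m => u m) n.
pose eta := \sum_(0 <= m < n.+1) v m *: u m.
have xeta : x eta = \sum_(0 <= m < n.+1) lam m *: (v m *: u m).
  rewrite linear_sum; apply: eq_bigr => i _.
  by rewrite linearZ /= xP !scalerA mulrC.
have orth (a b : R[i]) i j : i <> j -> inner (a *: u i) (b *: u j) = 0.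
  move=> ij; have [_ _ Padj] := (famP i).1.
  by rewrite -!linearZ /= Padj orthP// inner0r.
have eta_sqr : nrm 0 eta ^+ 2 = \sum_(0 <= m < n.+1) nrm 0 (v m *: u m) ^+ 2.
  by apply: nrm_sqr_sum => i j; exact: orth.
have xeta_sqr : nrm 0 (x eta) ^+ 2 =
    \sum_(0 <= m < n.+1) (normc (lam m) * nrm 0 (v m *: u m)) ^+ 2.
  rewrite xeta nrm_sqr_sum; last by move=> i j ij; rewrite !scalerA; exact: orth.
  apply: eq_bigr => i _; congr (_ ^+ 2).
  by rewrite -nrmZ// wnorm_l2_lty.
(* If [eta] vanished, so would each orthogonal component, in particular [v m *: u m] with [v m] and
   [u m] nonzero. *)
have eta_gt0 : 0 < nrm 0 eta.
  rewrite lt_neqAle nrm_ge0 andbT eq_sym; apply: contra_neq (u0 m) => eta0.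
  apply: (scalerI vm0); rewrite scaler0; apply: nrm0_eq0; apply/eqP.
  rewrite -sqrf_eq0 eq_le sqr_ge0 andbT.
  apply: (@le_trans _ _ (nrm 0 eta ^+ 2)); last by rewrite eta0 expr0n.
  rewrite eta_sqr (bigD1_seq m) ?mem_index_iota ?iota_uniq//= lerDl.
  by apply: sumr_ge0 => i _; exact: sqr_ge0.
have lam_le : normc (lam n) * nrm 0 eta <= nrm 0 (x eta).
  rewrite -ler_sqr ?nnegrE ?mulr_ge0 ?normc_ge0 ?nrm_ge0//.
  rewrite exprMn eta_sqr xeta_sqr mulr_sumr big_nat [leRHS]big_nat.
  apply: ler_sum => i /andP[_ iSn]; rewrite exprMn ler_wpM2r ?sqr_ge0//.
  by rewrite lerXn2r ?nnegrE ?normc_ge0// lam_dec.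
have [xetaoo xetaC] := xC eta.
have x_le : nrm 0 (x eta) <= nrm q%:Z (x eta).
  rewrite -lee_fin -(nrmE _ _ xetaoo) -(nrmE _ _ (wnorm_l2_lty _)).
  by apply: le_wnorm; rewrite lez_nat.
have eta_q : nrm (- q%:Z) eta <= n.+1%:R ^- q * nrm 0 eta.
  rewrite -lee_fin EFinM -(nrmE _ _ (wnorm_neg_l2_lty q _)) -(nrmE _ _ (wnorm_l2_lty _)).
  have := wnorm_sub_trunc 0 q n eta; rewrite add0r.
  suff -> : trunc n eta = 0 by rewrite subr0.
  apply/funext => j; rewrite /trunc; case: ifP => // jn.
  transitivity (\sum_(0 <= m < n.+1) v m * u m j); last exact: v_rel.
  rewrite /eta; elim: (n.+1) => [|k IHk]; first by rewrite !big_geq.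
  by rewrite !big_nat_recr//= -IHk.
rewrite -(ler_pM2r eta_gt0) mulrAC.
apply: (@le_trans _ _ (C * (n.+1%:R ^- q * nrm 0 eta) * n.+1%:R ^+ q)).
  rewrite ler_wpM2r ?exprn_ge0//; apply: le_trans lam_le _.
  by apply: le_trans x_le _; apply: le_trans xetaC _; rewrite ler_wpM2l.
by rewrite -!mulrA [nrm 0 eta * _]mulrC mulKf// expf_neq0.
Qed.

End spectral.

(** * The implications between the four conditions *)

Section equivalences.
Context {R : realType}.
Implicit Types (x : {linear l2_space R -> l2_space R}) (q : nat).
Implicit Types (P : nat -> {linear l2_space R -> l2_space R}) (lam : nat -> R[i]).

Lemma smooth_bound_fine (p : {linear l2_space R -> l2_space R}) q : in_Lss p ->
  smooth_bound q (fine (Lss_norm_l2 q p)) p.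
Proof. by move=> p_in; have [r _ [-> ]] := Lss_norm_l2P p p_in q. Qed.

Lemma fine_Lss_norm_l2_le (p : {linear l2_space R -> l2_space R}) q (C : R) :
  in_Lss p -> 0 <= C -> smooth_bound q C p -> fine (Lss_norm_l2 q p) <= C.
Proof. by move=> p_in; have [r _ [-> _ ]] := Lss_norm_l2P p p_in q; exact. Qed.

Lemma Lss_norm_l2_fineK (p : {linear l2_space R -> l2_space R}) q : in_Lss p ->
  Lss_norm_l2 q p = (fine (Lss_norm_l2 q p))%:E.
Proof. by move=> p_in; have [r _ [-> _ _]] := Lss_norm_l2P p p_in q. Qed.

(** At $q = 0$ input and output norms coincide, and a nonzero projection fixes a nonzero vector. *)
Lemma fine_Lss_norm_l2_ge1 (p : {linear l2_space R -> l2_space R}) :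
  projection p -> (exists xi, p xi != 0) -> in_Lss p ->
  1 <= fine (Lss_norm_l2 0 p).
Proof.
move=> [_ pp _] [xi pxi0] p_in.
have ppE : p (p xi) = p xi := pp xi.
have [_] := (smooth_boundP 0 _ p).1 (smooth_bound_fine p 0 p_in) (p xi).
rewrite oppr0 ppE -[leLHS]mul1r ler_pM2r// lt_neqAle nrm_ge0 andbT eq_sym.
by apply: contra_neq pxi0 => /nrm0_eq0.
Qed.

Lemma in_Lss_eigenprojection x (p : {linear l2_space R -> l2_space R}) (c : R[i]) :
  projection p -> c != 0 -> (forall xi, x (p xi) = c *: p xi) ->
  in_Lss x -> in_Lss p.
Proof.
move=> proj_p c0 xp /in_LssP xb; apply/in_LssP => q; have [C C0 xC] := xb q.
exists ((C / normc c) ^+ 2); first exact: sqr_ge0.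
exact: smooth_bound_eigenprojection xC.
Qed.

Lemma rapid_powR_mul_Lss_norm x lam P q (theta : R) :
  infinite_spectral_rep x lam P -> in_Lss x -> 0 < theta ->
  rapid (fun n => normc (lam n) `^ theta * fine (Lss_norm_l2 q (P n))).
Proof.
move=> rep x_in theta0; have xP := infinite_spectral_range x lam P rep.
have [[lam0 _ lam_dec famP _] _ _] := rep.
have projP n : projection (P n) by have [] := famP n I.
have P_in n : in_Lss (P n).
  by apply: in_Lss_eigenprojection (xP n) x_in => //; exact: lam0.
have lam_gt0 n : 0 < normc (lam n).
  rewrite lt_neqAle normc_ge0 andbT eq_sym.
  by apply: contra_neq (lam0 n I) => /eq0_normc.
have lam_rapid : rapid (fun n => normc (lam n)).
  move=> p; have [C C0 xC] := (in_LssP x).1 x_in p.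
  by exists C; exact: eigenvalue_decay rep C0 xC.
(* Of the exponent 3, two units cancel the factor $|\lambda_n|^{-2}$ in the bound for
   $\|P_n\|_q^{2^k}$, and one is left to supply rapid decay. *)
have [k k_theta] : exists k, 3 <= theta * (2 ^ k)%:R.
  exists (Num.bound (3 / theta)); rewrite mulrC -ler_pdivrMr//.
  have /archi_boundP/ltW : 0 <= 3 / theta by rewrite divr_ge0// ltW.
  by move=> /le_trans; apply; rewrite ler_nat ltnW// ltn_expl.
have [C C0 xC] := (in_LssP x).1 x_in (2 ^ k * q)%N.
have m0 : (0 < 2 ^ k)%N by rewrite expn_gt0.
set m := (2 ^ k)%N in k_theta xC m0.
apply: (rapid_root m) => // [n|].
  by rewrite mulr_ge0 ?powR_ge0 ?fine_Lss_norm_l2_ge0.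
(* The surplus power is harmless: $|\lambda_n|^e \le |\lambda_0|^e$ in the shifted indexing, since
   the moduli do not increase. *)
pose e := theta * m%:R - 3; have e0 : 0 <= e by rewrite subr_ge0.
apply: (rapid_le (normc (lam 0) `^ e * C ^+ 2) _ (fun n => normc (lam n))) => //.
  by rewrite mulr_ge0 ?powR_ge0 ?sqr_ge0.
move=> n; set a := normc (lam n); have a0 : 0 < a := lam_gt0 n.
have powE : (a `^ theta) ^+ m = a `^ e * a ^+ 3.
  rewrite -powR_mulrn ?powR_ge0// -powRrM -(powR_mulrn 3 (ltW a0)) -powRD ?subrK//.
  by apply/implyP => _; rewrite gt_eqF.
have normP : fine (Lss_norm_l2 q (P n)) ^+ m <= (C / a) ^+ 2.
  apply: le_trans (Lss_norm_l2_interpolation_iter (P n) q k (projP n) (P_in n)) _.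
  apply: fine_Lss_norm_l2_le => //; first exact: sqr_ge0.
  exact: smooth_bound_eigenprojection (lam0 n I) (xP n) C0 xC.
rewrite exprMn powE.
apply: (@le_trans _ _ (a `^ e * a ^+ 3 * (C / a) ^+ 2)).
  by rewrite ler_wpM2l// mulr_ge0 ?powR_ge0 ?exprn_ge0// ltW.
have -> : a `^ e * a ^+ 3 * (C / a) ^+ 2 = a `^ e * (C ^+ 2 * a).
  by field; rewrite gt_eqF.
rewrite -mulrA ler_wpM2r ?mulr_ge0 ?sqr_ge0 ?(ltW a0)//.
by rewrite ge0_ler_powR ?nnegrE ?normc_ge0// lam_dec.
Qed.

(** The sum of the series bounds every partial sum of the spectral series at level [q], and the
    bound passes to the coordinatewise limit. *)
Lemma in_Lss_of_summable x lam P : infinite_spectral_rep x lam P ->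
  (forall n, in_Lss (P n)) ->
  (forall q, (\sum_(0 <= n <oo) (normc (lam n))%:E * Lss_norm_l2 q (P n) < +oo)%E) ->
  in_Lss x.
Proof.
move=> rep P_in summable; apply/in_LssP => q.
pose c n := fine (Lss_norm_l2 q (P n)).
have c0 n : 0 <= c n by exact: fine_Lss_norm_l2_ge0.
have t0 n : 0 <= normc (lam n) * c n by rewrite mulr_ge0 ?normc_ge0.
have := summable q.
rewrite (eq_eseriesr (g := fun n => (normc (lam n) * c n)%:E)); last first.
  by move=> n _; rewrite Lss_norm_l2_fineK.
set S := (\sum_(0 <= n <oo) _)%E => Soo.
have S0 : (0 <= S)%E by apply: nneseries_ge0 => n _ _; rewrite lee_fin.
have SE : S = (fine S)%:E by rewrite fineK// ge0_fin_numE.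
exists (fine S); first exact: fine_ge0.
move=> xi; have xioo := wnorm_neg_l2_lty q xi.
rewrite (nrmE _ _ xioo) -EFinM.
apply: (wnorm_lim _ _ _ _ _ (infinite_spectral_cvg x lam P rep xi)) => N.
apply: le_trans (wnorm_sum_le P lam q c N xi _) _.
  by move=> n _; split=> //; exact: smooth_bound_fine.
rewrite EFinM -SE (nrmE _ _ xioo) lee_wpmul2r ?lee_fin ?nrm_ge0//.
by rewrite -sumEFin; apply: nneseries_lim_ge => n _ _; rewrite lee_fin.
Qed.

End equivalences.

Theorem corollary3p6 (R : realType) :
  (forall (x : {linear l2_space R -> l2_space R}) (lam : nat -> R[i])
      (P : nat -> {linear l2_space R -> l2_space R}),
    compact_op x -> ~ finite_rank x -> normal_op x ->
    infinite_spectral_rep x lam P ->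
    [<-> in_Lss x;
         (forall n, in_Lss (P n)) /\
         (forall (q : nat) (theta : R), 0 < theta <= 1 ->
            (fun n => (normc (lam n) `^ theta *
                       fine (Lss_norm_l2 q (P n)))%:C) \in in_s R);
         [/\ forall n, in_Lss (P n),
             lam \in in_s R &
             forall q : nat, (ereal_sup (range (fun n =>
               (normc (lam n))%:E * Lss_norm_l2 q (P n))) < +oo)%E];
         (forall n, in_Lss (P n)) /\
         (forall q : nat, (\sum_(0 <= n <oo)
            (normc (lam n))%:E * Lss_norm_l2 q (P n) < +oo)%E)])
  /\
  (forall (N : nat) (x : {linear l2_space R -> l2_space R}) (lam : nat -> R[i])
      (P : nat -> {linear l2_space R -> l2_space R}),
    finite_rank x -> normal_op x -> finite_spectral_rep N x lam P ->
    (in_Lss x <-> forall n, (n < N)%N -> in_Lss (P n))).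
Proof.
split=> [x lam P _ _ _ rep | N x lam P _ _ [fam xE]].
  have [[lam0 _ lam_dec famP _] _ _] := rep.
  have projP n : projection (P n) by have [] := famP n I.
  tfae.
  - move=> x_in; have P_in n : in_Lss (P n).
      apply: in_Lss_eigenprojection (infinite_spectral_range x lam P rep n) x_in => //.
      exact: lam0.
    split=> // q theta /andP[theta0 _]; apply/in_s_rapidP.
    apply: (rapid_le 1 _ _ ler01 _
      (rapid_powR_mul_Lss_norm x lam P q theta rep x_in theta0)) => n.
    by rewrite mul1r normc_real ger0_norm// mulr_ge0 ?powR_ge0 ?fine_Lss_norm_l2_ge0.
  - move=> [P_in P_rapid].
    (* The value $\theta = 1$ yields (iii): $q = 0$ with $\|P_n\|_0 \ge 1$ controls the eigenvalues,
       and decay of order 0 gives the suprema. *)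
    have {}P_rapid q : rapid (fun n => normc (lam n) * fine (Lss_norm_l2 q (P n))).
      have := P_rapid q 1; rewrite ltr01 lexx => /(_ isT)/in_s_rapidP.
      apply: (rapid_le 1 _ _ ler01) => n.
      by rewrite mul1r normc_real powRr1 ?normc_ge0// ler_norm.
    split=> [//||q].
      apply/in_s_rapidP; apply: (rapid_le 1 _ _ ler01 _ (P_rapid 0%N)) => n.
      rewrite mul1r ler_peMr ?normc_ge0// fine_Lss_norm_l2_ge1//.
      by have [] := famP n I.
    have [C PC] := P_rapid q 0%N; apply: (@le_lt_trans _ _ C%:E); last exact: ltry.
    apply: ge_ereal_sup => _ [n _ <-].
    by rewrite Lss_norm_l2_fineK// -EFinM lee_fin; have := PC n; rewrite mulr1.
  - move=> [P_in /in_s_rapidP lam_rapid P_sup]; split=> // q.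
    rewrite (eq_eseriesr (g := fun n =>
        (normc (lam n) * fine (Lss_norm_l2 q (P n)))%:E)); last first.
      by move=> n _; rewrite Lss_norm_l2_fineK.
    have t0 k n : 0 <= normc (lam n) * fine (Lss_norm_l2 k (P n)).
      by rewrite mulr_ge0 ?normc_ge0 ?fine_Lss_norm_l2_ge0.
    (* It suffices that the squares decay rapidly, since interpolation bounds $\|P_n\|_q^2$ by
       $\|P_n\|_{2q}$. *)
    apply: rapid_summable => //; apply: (rapid_root 2) => //.
    have := P_sup (2 * q)%N; set S := ereal_sup _ => Soo.
    have S_ub n : ((normc (lam n) * fine (Lss_norm_l2 (2 * q) (P n)))%:E <= S)%E.
      by apply: ereal_sup_ubound; exists n => //; rewrite Lss_norm_l2_fineK.
    have S0 : (0 <= S)%E by apply: le_trans (S_ub 0%N); rewrite lee_fin.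
    have SE : S = (fine S)%:E by rewrite fineK// ge0_fin_numE.
    apply: (rapid_le (fine S) _ (fun n => normc (lam n))) => //; first exact: fine_ge0.
    move=> n; rewrite exprMn expr2 -mulrA mulrC ler_wpM2r ?normc_ge0//.
    apply: (@le_trans _ _ (normc (lam n) * fine (Lss_norm_l2 (2 * q) (P n)))).
      by rewrite ler_wpM2l ?normc_ge0// Lss_norm_l2_interpolation.
    by rewrite -lee_fin -SE.
  - by move=> [P_in]; exact: in_Lss_of_summable.
(* For finite rank the same eigenprojection estimate and termwise bounds apply, with finite sums in
   place of limits. *)
have [lam0 _ _ famP _] := fam.
have projP n : (n < N)%N -> projection (P n) by move=> /famP[].
split=> [x_in n nN | P_in].
  apply: (in_Lss_eigenprojection x _ (lam n)) x_in => //; [exact: projP|exact: lam0|].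
  by move=> xi; rewrite xE; exact: spectral_sum_range fam _ nN.
apply/in_LssP => q; pose c n := fine (Lss_norm_l2 q (P n)).
have c_bound n : (n < N)%N -> 0 <= c n /\ smooth_bound q (c n) (P n).
  by move=> /P_in Pn; split; [exact: fine_Lss_norm_l2_ge0|exact: smooth_bound_fine].
exists (\sum_(0 <= n < N) normc (lam n) * c n).
  rewrite big_nat; apply: sumr_ge0 => n /andP[_ /c_bound[c0 _]].
  by rewrite mulr_ge0 ?normc_ge0.
by move=> xi; rewrite xE; exact: wnorm_sum_le.
Qed.
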